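(* Fix $N$, $K\ge1$, $P^N\in\mathcal M^{np,N}$ and $\psi\in[0,1]$. Suppose: (1) $\mathcal B$ is a convex subset of $\mathbb R^d$ for some positive integer $d$, the maps $\bar t_l^N$, $l\in[L^N]$, take values in $(0,\infty)$, $g$ takes values in $(0,1)$, and $\bar t_l^N$ ($l\in[L^N]$) and $g$ are log-concave on $\mathcal B$; (2) $\mathcal B$ is compact (with its Euclidean metric), $\mathscr B$ is its Borel $\sigma$-field, and $g$ and $\bar t_l^N$ ($l\in[L^N]$) are continuous on $\mathcal B$; (3) there exist $r^\star\in\mathcal R^{N,K}(P^N,\psi)$ and $(w^\star,\beta^\star)\in\Delta_K\times\mathcal B^K$ with $r^\star=q^N_{w^\star,\beta^\star}$, and $w_k^\star>0$, $\beta_k^\star\in\mathrm{int}(\mathcal B)$ for every $k\in[K]$; (4) there exist an open set $\Theta_0\subseteq\mathbb R^{K-1}\times\mathbb R^{dK}$ and a neighborhood $U_0$ of $(w^\star,\beta^\star)$ in $\Delta_K\times\mathcal B^K$ with $\overline{U_0}\subseteq\Delta_K\times\mathrm{int}(\mathcal B)^K$ such that (i) the map $\iota:\Theta_0\to U_0$, $\theta=(w_1,\dots,w_{K-1},\beta_1,\dots,\beta_K)\mapsto(w,\beta)$ with $w_K=1-\sum_{k<K}w_k$, is a $C^1$ bijection with $\iota(\theta^\star)=(w^\star,\beta^\star)$ for some $\theta^\star\in\Theta_0$; (ii) $(w^\star,\beta^\star)$ is the unique $(w,\beta)\in\overline{U_0}$ with $q^N_{w,\beta}=q^N_{w^\star,\beta^\star}$;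 (5) there is an open set $B_0\subseteq\mathrm{int}(\mathcal B)$ containing $\beta_1^\star,\dots,\beta_K^\star$ on which $\bar t_l^N$ ($l\in[L^N]$) and $g$ are twice continuously differentiable; (6) $\theta\mapsto\mathrm{KL}(r^\star\|q^N_{\iota(\theta)})$ is twice continuously differentiable on $\Theta_0$ and its Hessian at $\theta^\star$ is positive definite; (7) the function $\rho(\theta)=\inf_{r\in\mathcal R^{N,K}(P^N,\psi)}\mathrm{KL}(r\|q^N_{\iota(\theta)})$ is twice continuously differentiable at $\theta^\star$ with $\nabla^2_\theta\rho(\theta^\star)\succ0$; (8) there is a neighborhood $W_0\subseteq\mathcal R^{N,K}(P^N,\psi)$ of $r^\star$ such that for every $r\in W_0$ the right projection problem at $r$ has a unique minimizer $\mathrm{RightProjection}(r)$, and $r\mapsto\mathrm{RightProjection}(r)$ is of class $C^1$ on $W_0$. Then there exists a subset $U\subseteq\Delta_K\times\mathcal B^K$ such that, if $(w^{(0)},\beta^{(0)})\in U$, then $d^{(h)}(\psi)\to0$ as $h\to\infty$. As a consequence, for every $\epsilon>0$ there exists a positive integer $H$ such that for every $h\ge H$, $$\mathbb P\big(\mathrm{Certify}(\psi,P^N,K,\epsilon,h)=\mathrm{TRUE}\big)>0 .$$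
   Context: Write $[m]=\{1,\dots,m\}$, $\Delta_K=\{q\in[0,1]^K:\sum_kq_k=1\}$, and let $\Delta_{K\times L\times2}$ be the set of probability vectors on $[K]\times[L]\times[2]$. $\mathrm{KL}(r\|q)=\sum_xr(x)\log\frac{r(x)}{q(x)}$ with $0\log(0/q)=0$, $r\log(r/0)=+\infty$ for $r>0$. Let $J,T\ge 1$ be integers and $\mathcal A_T=\{A_1\times\cdots\times A_T: \varnothing\neq A_t\subseteq[J]\}$. For an integer $N\ge1$ fix a design $a_1^N,\dots,a_N^N\in\mathcal A_T$, let $\mathcal Y^N=a_1^N\times\cdots\times a_N^N$ and let $\mathcal M^{np,N}$ be the set of all probability measures on the finite set $\mathcal Y^N$. Let $(\mathcal B,\mathscr B)$ be a measurable space. A choice kernel is a measurable map $s:\mathcal B\times\mathcal A_T\times[J]^T\to[0,1]$ (discrete $\sigma$-algebras on the finite factors) with $s(\beta,a,y)=0$ if $y\notin a$ and $\sum_{y\in a}s(\beta,a,y)=1$ for all $(\beta,a)$; fix one. Let $g:\mathcal B\to[0,1]$ be measurable. Let $\mathcal D^N=\{(a,y):a\in\{a_1^N,\dots,a_N^N\},y\in a\}$, $n_a=\#\{i\in[N]:a_i^N=a\}$, $L^N=\#\mathcal D^N$, $(a(l),y(l))_{l\in[L^N]}$ an ordering of $\mathcal D^N$, $\bar t^N_l(\beta)=s(\beta,a(l),y(l))$, and $\bar b^N_l(P^N)=\frac1{n_{a(l)}}\sum_{i:a_i^N=a(l)}P^N_i(y(l))$ with $P^N_i$ the $i$-th marginal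 of $P^N$. Let $e_l^N=n_{a(l)}/N$, $\bar\alpha_l^N(P^N)=e_l^N\bar b_l^N(P^N)$, $\varpi_\psi(1)=\psi$, $\varpi_\psi(2)=1-\psi$, $\gamma(1,\beta)=g(\beta)$, $\gamma(2,\beta)=1-g(\beta)$, $$\mathcal R^{N,K}(P^N,\psi)=\Big\{r\in\Delta_{K\times L^N\times2}:\ \sum_{k=1}^K\sum_{m=1}^2r(k,l,m)=\bar\alpha^N_l(P^N)\ \forall l,\ \ \sum_{k=1}^K\sum_{l=1}^{L^N}r(k,l,m)=\varpi_\psi(m)\ \forall m\Big\},$$ and $q^N_{w,\beta}(k,l,m)=w_k\,e_l^N\,\bar t_l^N(\beta_k)\,\gamma(m,\beta_k)$ for $w\in\Delta_K$, $\beta\in\mathcal B^K$ (for $\iota(\theta)=(w,\beta)$, $q^N_{\iota(\theta)}$ means $q^N_{w,\beta}$). $\mathrm{LeftProjection}(w,\beta)$ is an oracle returning a minimizer of $r\mapsto\mathrm{KL}(r\|q^N_{w,\beta})$ over $r\in\mathcal R^{N,K}(P^N,\psi)$. $\mathrm{RightProjection}(r)$ is an oracle returning a minimizer over $(w,\beta)\in\Delta_K\times\mathcal B^K$ of the right projection problem $\min_{w,\beta}\mathrm{KL}(r\|q^N_{w,\beta})=\min_{w,\beta}\sum_{k,l,m}r(k,l,m)\log\frac{r(k,l,m)}{w_ke_l^N\bar t_l^N(\beta_k)\gamma(m,\beta_k)}$. From an initialization $(w^{(0)},\beta^{(0)})\in\Delta_K\times\mathcal B^K$ put $r^{(0)}=\mathrm{LeftProjection}(w^{(0)},\beta^{(0)})$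 and for $h\ge0$: $(w^{(h+1)},\beta^{(h+1)})=\mathrm{RightProjection}(r^{(h)})$, $r^{(h+1)}=\mathrm{LeftProjection}(w^{(h+1)},\beta^{(h+1)})$, $d^{(h+1)}(\psi)=\mathrm{KL}(r^{(h+1)}\|q^N_{w^{(h+1)},\beta^{(h+1)}})$. The algorithm $\mathrm{Certify}(\psi,P^N,K,\epsilon,H_{\max})$ draws a random initialization $(w^{(0)},\beta^{(0)})\in\Delta_K\times\mathcal B^K$, runs these iterations, and returns $\mathrm{TRUE}$ if $d^{(h)}(\psi)\le\epsilon$ for some $h\in\{1,\dots,H_{\max}\}$, and $\mathrm{FALSE}$ otherwise. The law of the random initialization assigns positive probability to every subset of $\Delta_K\times\mathcal B^K$ of positive relative Lebesgue measure. $\mathbb P$ refers to the random initialization. *)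

(* Defs.v *)
From HB Require Import structures.
From mathcomp Require Import all_boot all_order all_algebra.
From mathcomp Require Import all_classical all_reals all_analysis.

Set Implicit Arguments.
Unset Strict Implicit.
Unset Printing Implicit Defensive.

Import Order.TTheory GRing.Theory Num.Theory numFieldNormedType.Exports.

Open Scope classical_set_scope.
Open Scope ring_scope.

Section FiniteLaws.
Context {R : realType}.

Definition simplex (X : finType) : set (X -> R) :=
  [set q | (forall x, 0 <= q x <= 1) /\ \sum_x q x = 1].

(* The three cases are 0 log(0/q) = 0, r log(r/0) = +oo and r log(r/q). *)
Definition KL (X : finType) (r q : X -> R) : \bar R :=
  (\sum_x (if (r x == 0)%R then 0
           else if (q x == 0)%R then +oo
           else (r x * ln (r x / q x))%R%:E))%E.

(* A law on {1, 2}; the index 1 is [ord0]. *)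
Definition binary_law (c : R) (m : 'I_2) : R := if m == ord0 then c else 1 - c.

End FiniteLaws.

Section Smoothness.
Context {R : realType}.

(* On finite-dimensional spaces, strong continuity of the derivative is
   continuity in operator norm, so these are the classes C^1 and C^2 on the
   open set [A]. *)
Definition C1_on (V W : normedModType R) (A : set V) (f : V -> W) :=
  forall x, A x ->
    differentiable f x /\ forall v, {for x, continuous ('D_v f)}.

Definition C2_on (V W : normedModType R) (A : set V) (f : V -> W) :=
  C1_on A f /\ forall v, C1_on A ('D_v f).

Definition C2_at (V W : normedModType R) (x : V) (f : V -> W) :=
  exists A : set V, [/\ open A, A x & C2_on A f].

(* For a set [A] that is not open: [f] extends locally to a C^1 map. *)
Definition C1_on_subset (V W : normedModType R) (A : set V) (f : V -> W) :=
  forall x, A x -> exists (O : set V) (F : V -> W),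
    [/\ open O, O x, C1_on O F & forall y, O y -> A y -> F y = f y].

Definition hessian (V : normedModType R) (f : V -> R) (x u v : V) : R :=
  'D_u ('D_v f) x.

Definition positive_definite (V : normedModType R) (H : V -> V -> R) :=
  forall u, u != 0 -> 0 < H u u.

Definition log_concave d (B : set 'rV[R]_d) (f : 'rV[R]_d -> R) :=
  @convex_function R 'rV[R]_d B (fun b => - ln (f b)).

Definition relative_nbhs (T : topologicalType) (D : set T) (x : T) (U : set T) :=
  [/\ U `<=` D, U x & within D (nbhs x) U].

End Smoothness.

Notation borel T := (g_sigma_algebraType (@open T)).

(* The probability of an event that is not known to be measurable is read as its
   inner probability. *)
Definition inner_prob d (T : measurableType d) (R : realType)
    (P : probability T R) (A : set T) : \bar R :=
  ereal_sup [set P E | E in [set E | measurable E /\ E `<=` A]].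

Lemma inner_prob_measurable d (T : measurableType d) (R : realType)
    (P : probability T R) (A : set T) :
  measurable A -> inner_prob P A = P A.
Proof.
move=> mA; apply/eqP; rewrite eq_le; apply/andP; split.
  by apply: ge_ereal_sup => _ [E [mE EA] <-]; apply: le_measure; rewrite ?inE.
by apply: ereal_sup_ubound; exists A => //; split.
Qed.

Section DiscreteChoice.
Context {R : realType} {J T : nat}.

Definition profile := {ffun 'I_T -> 'I_J}.
Definition menu := {set profile}.

Definition prod_menu (A : {ffun 'I_T -> {set 'I_J}}) : menu :=
  [set y : profile | [forall t, y t \in A t]]%SET.

Definition menus : {set menu} :=
  [set prod_menu A | A : {ffun 'I_T -> {set 'I_J}} & [forall t, A t != finset.set0]]%SET.

(* [s] is the kernel on [B]; its values outside [B] are irrelevant. *)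
Definition choice_kernel d (B : set 'rV[R]_d)
    (s : 'rV[R]_d -> menu -> profile -> R) :=
  (forall a y, a \in menus ->
     measurable_fun (B : set (borel 'rV[R]_d)) (fun b => s b a y)) /\
  (forall b a, B b -> a \in menus ->
     [/\ forall y, 0 <= s b a y <= 1,
         forall y, y \notin a -> s b a y = 0
       & \sum_(y in a) s b a y = 1]).

Context {N : nat}.
Variable a : 'I_N -> menu.

Definition outcomes : {set {ffun 'I_N -> profile}} :=
  [set z : {ffun 'I_N -> profile} | [forall i, z i \in a i]]%SET.

Definition np_measures : set ({ffun 'I_N -> profile} -> R) :=
  [set P | simplex P /\ forall z, z \notin outcomes -> P z = 0].

Definition marginal (P : {ffun 'I_N -> profile} -> R) (i : 'I_N) (y : profile) : R :=
  \sum_(z : {ffun 'I_N -> profile} | z i == y) P z.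

Definition data : {set menu * profile} :=
  [set x : menu * profile | [exists i, a i == x.1] && (x.2 \in x.1)]%SET.

Definition multiplicity (A : menu) : nat := #|[set i | a i == A]%SET|.

Definition is_ordering L (lab : 'I_L -> menu * profile) :=
  injective lab /\ [set lab l | l : 'I_L]%SET = data.

Context {L : nat}.
Variable lab : 'I_L -> menu * profile.

Definition tbar d (s : 'rV[R]_d -> menu -> profile -> R) (l : 'I_L)
    (b : 'rV[R]_d) : R := s b (lab l).1 (lab l).2.

Definition bbar (P : {ffun 'I_N -> profile} -> R) (l : 'I_L) : R :=
  (multiplicity (lab l).1)%:R^-1 *
  \sum_(i | a i == (lab l).1) marginal P i (lab l).2.

Definition eN (l : 'I_L) : R := (multiplicity (lab l).1)%:R / N%:R.

Definition alphabar (P : {ffun 'I_N -> profile} -> R) (l : 'I_L) : R :=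
  eN l * bbar P l.

End DiscreteChoice.

(* An array r(k,l,m) is stored as a matrix, so that it lives in a normed space:
   its rows are indexed by the pairs (k,l). *)
Notation mass_array R K L := 'M[R]_(K * L, 2) (only parsing).

(* A pair (w,beta); beta_k is the k-th row of the second component. *)
Notation mix_param R K d := ('rV[R]_K * 'M[R]_(K, d))%type (only parsing).

(* The coordinates theta = (w_1,...,w_{K-1},beta_1,...,beta_K). *)
Notation chart_coord R K d := ('rV[R]_K.-1 * 'M[R]_(K, d))%type (only parsing).

Section Mixtures.
Context {R : realType} {K L d : nat}.

Definition entry (r : mass_array R K L) (x : 'I_K * 'I_L * 'I_2) : R :=
  r (mxvec_index x.1.1 x.1.2) x.2.

Definition param_set (B : set 'rV[R]_d) : set (mix_param R K d) :=
  [set p : mix_param R K d |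
    simplex (fun k => p.1 0 k) /\ forall k, B (row k p.2)].

Definition couplings (alpha : 'I_L -> R) (psi : R) : set (mass_array R K L) :=
  [set r : mass_array R K L | [/\ simplex (entry r),
      forall l, \sum_(k < K) \sum_(m < 2) entry r (k, l, m) = alpha l
    & forall m, \sum_(k < K) \sum_(l < L) entry r (k, l, m) = binary_law psi m]].

Definition mixture (e : 'I_L -> R) (t : 'I_L -> 'rV[R]_d -> R)
    (g : 'rV[R]_d -> R) (p : mix_param R K d) (x : 'I_K * 'I_L * 'I_2) : R :=
  let: (k, l, m) := x in
  p.1 0 k * e l * t l (row k p.2) * binary_law (g (row k p.2)) m.

Definition iota_chart (th : chart_coord R K d) : mix_param R K d :=
  (\row_(k < K) (if (insub (k : nat) : option 'I_K.-1) is Some j then th.1 0 j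
                 else 1 - \sum_(j < K.-1) th.1 0 j),
   th.2).

End Mixtures.

Section RelativeLebesgue.
Context {R : realType}.

(* n-dimensional Lebesgue measure of Borel sets, as an iterated product of the
   one-dimensional one; this is what [product_measure1] unfolds to. *)
Fixpoint lebesgue_rV n : set 'rV[R]_n -> \bar R :=
  if n is n'.+1 then fun A : set 'rV[R]_(1 + n') =>
    (\int[@lebesgue_measure R]_x
       @lebesgue_rV n' [set v | A (row_mx (x%:M : 'rV[R]_1) v)])%E
  else fun A : set 'rV[R]_0 => (\1_A 0 : R)%:E.

(* Lebesgue measure on Delta_K x (R^d)^K, of dimension K - 1 + K d, transported
   by the affine chart [iota_chart]. *)
Definition relative_lebesgue K d (S : set (mix_param R K d)) : \bar R :=
  @lebesgue_rV (K.-1 + K * d)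
    [set x | S (iota_chart (lsubmx x, vec_mx (rsubmx x)))].

End RelativeLebesgue.

Section Certification.
Context {R : realType} {K L d : nat}.
Variables (q : mix_param R K d -> 'I_K * 'I_L * 'I_2 -> R).

Definition divergence (r : mass_array R K L) (p : mix_param R K d) : \bar R :=
  KL (entry r) (q p).

Variables (C : set (mass_array R K L)) (D : set (mix_param R K d)).

Definition is_left_minimizer (p : mix_param R K d) (r : mass_array R K L) :=
  C r /\ forall r', C r' -> (divergence r p <= divergence r' p)%E.

Definition is_right_minimizer (r : mass_array R K L) (p : mix_param R K d) :=
  D p /\ forall p', D p' -> (divergence r p <= divergence r p')%E.

(* [fine] loses nothing where all the weights, t and g, 1 - g are positive and [C]
   is nonempty: the infimum is then finite. *)
Definition rho (th : chart_coord R K d) : R :=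
  fine (ereal_inf [set divergence r (iota_chart th) | r in C]).

Variables (left_proj : mix_param R K d -> mass_array R K L)
          (right_proj : mass_array R K L -> mix_param R K d).

(* (w^(h), beta^(h)) started at [p0] *)
Definition iterate (p0 : mix_param R K d) (h : nat) : mix_param R K d :=
  iter h (fun p => right_proj (left_proj p)) p0.

(* d^(h) *)
Definition gap (p0 : mix_param R K d) (h : nat) : \bar R :=
  divergence (left_proj (iterate p0 h)) (iterate p0 h).

Definition certify (eps : R) (Hmax : nat) (p0 : mix_param R K d) : bool :=
  [exists h : 'I_Hmax, (gap p0 h.+1 <= eps%:E)%E].

End Certification.

(* Main.v *)
(** One step of the algorithm is x |-> right(left(x)), and KL(left(x) || q_x) = rho(x)
    never increases along it.  Near theta* the function rho is C^2, vanishes at theta*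
    and has a positive definite Hessian, so that its radial derivative about theta* is
    positive away from theta*.  If r is a left projection at theta <> theta*, then
    KL(r || q_.) >= rho with equality at theta; the two functions have the same
    derivative there, which is not zero, hence theta is not a right projection of r and
    the step strictly decreases rho.  By compactness the decrease is uniform where
    rho >= eps.  The step is continuous at its fixed point theta*, so a small sublevel
    set of rho around theta* is invariant, and rho falls below any eps after a number of
    steps that does not depend on the starting point in this set. *)

Require Import Defs.
From HB Require Import structures.
From mathcomp Require Import all_boot all_order all_algebra.
From mathcomp Require Import all_classical all_reals all_analysis.
From mathcomp Require Import ring lra.
Import Order.TTheory GRing.Theory Num.Theory numFieldNormedType.Exports.

(** * Directional derivatives, minima and the radial derivative *)

Section Calculus.
Set Implicit Arguments.
Unset Strict Implicit.
Unset Printing Implicit Defensive.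
Local Open Scope classical_set_scope.
Local Open Scope ring_scope.
Context {R : realType}.
Implicit Types V W : normedModType R.

Lemma cvg_fsum T (F : set_system T) {FF : Filter F} (I : finType)
    (f : I -> T -> R) (l : I -> R) :
  (forall i, f i x @[x --> F] --> l i) ->
  \sum_i f i x @[x --> F] --> \sum_i l i.
Proof. by move=> fl; apply: cvg_big => //; exact: add_continuous. Qed.

(** Both sides have the same difference quotient. This turns statements along a ray into
    one-variable ones, to which the mean value theorem applies. *)
Lemma is_derive_line V W (f : V -> W) (x u : V) (s : R) (df : W) :
  is_derive (x + s *: u) u f df ->
  is_derive s 1 (fun s => f (x + s *: u)) df.
Proof.
move=> [dx <-].
have E : (fun h : R => h^-1 *: (f (x + (h *: (1:R) + s) *: u) - f (x + s *: u))) =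
  (fun h : R => h^-1 *: (f (h *: u + (x + s *: u)) - f (x + s *: u))).
  apply/funext => h; congr (_ *: (f _ - _)).
  by rewrite [h *: _]mulr1 scalerDl addrCA.
by split; rewrite /derivable /derive /= /shift /= E.
Qed.

(** The difference quotient is nonnegative for small h > 0 and nonpositive for small h < 0, and both
    one-sided limits equal the derivative. *)
Lemma derive_local_min V (f : V -> R) (x v : V) :
  derivable f x v -> (\forall y \near x, f x <= f y) -> 'D_v f x = 0.
Proof.
move=> dfx fmin.
have hmin : \forall h \near (0 : R), f x <= f (h *: v + x).
  have : (fun h : R => h *: v + x) @ (0 : R) --> x.
    rewrite -[X in _ --> X]add0r -(scale0r v).
    by apply: cvgD; [exact: scalel_continuous|exact: cvg_cst].
  by move=> /(_ _ fmin).
have [dr dl] : (h^-1 *: (f (h *: v + x) - f x) @[h --> (0 : R)^'+] --> 'D_v f x)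
    /\ (h^-1 *: (f (h *: v + x) - f x) @[h --> (0 : R)^'-] --> 'D_v f x).
  split; move=> B /dfx [e e0 Be]; exists e => // h he h0; apply: Be => //.
    by rewrite gt_eqF.
  by rewrite lt_eqF.
apply/eqP; rewrite eq_le; apply/andP; split.
  apply: (cvgr_to_le dl); near=> h; apply: mulr_le0_ge0.
    by rewrite invr_le0 ltW.
  by rewrite subr_ge0; near: h; exact: (cvg_within _ hmin).
apply: (cvgr_to_ge dr); near=> h; apply: mulr_ge0.
  by rewrite invr_ge0 ltW.
by rewrite subr_ge0; near: h; exact: (cvg_within _ hmin).
Unshelve. all: by end_near. Qed.

(** By linearity the two difference quotients coincide. With it, smoothness and Hessians pass from
    the pair-valued chart to plain row vectors. *)
Lemma derive_comp_linear V W V' (f : W -> V') (Phi : {linear V -> W}) (u : V) :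
  'D_u (f \o Phi) = 'D_(Phi u) f \o Phi.
Proof.
apply/funext => x /=; rewrite /derive /=.
by under eq_fun do rewrite linearP.
Qed.

Lemma hessian_comp_linear V W (f : W -> R) (Phi : {linear V -> W}) (x u v : V) :
  hessian (f \o Phi) x u v = hessian f (Phi x) (Phi u) (Phi v).
Proof.
rewrite /hessian (derive_comp_linear f Phi v).
exact: (congr1 (@^~ x) (derive_comp_linear ('D_(Phi v) f) Phi u)).
Qed.

Lemma C1_on_comp_linear V W V' (A : set W) (f : W -> V') (Phi : {linear V -> W}) :
  continuous Phi -> C1_on A f -> C1_on (Phi @^-1` A) (f \o Phi).
Proof.
move=> cPhi fA x /= /fA[dfx cfx]; split.
  by apply: differentiable_comp => //; exact: linear_differentiable.
move=> v; rewrite derive_comp_linear.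
by apply: continuous_comp => //; exact: cPhi.
Qed.

Lemma C2_on_comp_linear V W V' (A : set W) (f : W -> V') (Phi : {linear V -> W}) :
  continuous Phi -> C2_on A f -> C2_on (Phi @^-1` A) (f \o Phi).
Proof.
move=> cPhi [f1 f2]; split; first exact: C1_on_comp_linear.
by move=> v; rewrite derive_comp_linear; exact: C1_on_comp_linear.
Qed.

Lemma derive_rV_sum n V (f : 'rV[R]_n -> V) (x v : 'rV[R]_n) :
  differentiable f x -> 'D_v f x = \sum_j v 0 j *: 'D_(delta_mx 0 j) f x.
Proof.
move=> dfx; rewrite deriveE // [in LHS](row_sum_delta v) linear_sum.
by apply: eq_bigr => j _; rewrite linearZ /= deriveE.
Qed.

(* The gradient vanishes at x0 and, by the mean value theorem along the ray,
   'D_(x - x0) f x is the Hessian form at an intermediate point. *)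
Lemma derive_radial_gt0 n (A : set 'rV[R]_n) (f : 'rV[R]_n -> R) (x0 : 'rV[R]_n) :
  open A -> A x0 -> C2_on A f -> positive_definite (hessian f x0) ->
  (forall v, 'D_v f x0 = 0) ->
  \forall x \near x0, x != x0 -> 0 < 'D_(x - x0) f x.
Proof.
move=> oA Ax0 [f1 f2] Hpd crit.
(* [C2_on] gives continuity of second derivatives for each fixed pair of directions; expanding the
   form in coordinates makes it jointly continuous in the point and the direction. *)
pose H i j := 'D_(delta_mx 0 i) ('D_(delta_mx 0 j) f) : 'rV[R]_n -> R.
pose Q (x u : 'rV[R]_n) := \sum_j \sum_i u 0 j * (u 0 i * H i j x).
have QE x u : A x -> Q x u = \sum_j u 0 j * 'D_u ('D_(delta_mx 0 j) f) x.
  move=> Ax; apply: eq_bigr => j _; rewrite -mulr_sumr; congr (_ * _).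
  by rewrite derive_rV_sum //; case: (f2 (delta_mx 0 j) x Ax).
have fE x u : A x -> 'D_u f x = \sum_j u 0 j * 'D_(delta_mx 0 j) f x.
  by move=> Ax; rewrite derive_rV_sum //; case: (f1 x Ax).
have dline x u (s : R) : A (x + s *: u) ->
    is_derive s 1 (fun s => \sum_j u 0 j * 'D_(delta_mx 0 j) f (x + s *: u)) (Q (x + s *: u) u).
  move=> Ax; rewrite QE //.
  have -> : (fun s => \sum_j u 0 j * 'D_(delta_mx 0 j) f (x + s *: u)) =
     \sum_j (u 0 j *: ((fun s : R => 'D_(delta_mx 0 j) f (x + s *: u)) : R -> R)).
    by apply/funext => s'; rewrite fct_sumE; apply: eq_bigr.
  apply: is_derive_sum => j; apply: is_deriveZ; apply: (@is_derive_line _ _ ('D_(delta_mx 0 j) f)).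
  by apply/derivableP/diff_derivable; case: (f2 (delta_mx 0 j) _ Ax).
have Q0 u : u != 0 -> 0 < Q x0 u.
  move=> u0; have := Hpd u u0; rewrite /hessian QE //.
  (* Near x0 the inner derivative is the finite sum of its coordinate parts, so the outer derivative
     can be taken term by term. *)
  suff -> : 'D_u ('D_u f) x0 = \sum_j u 0 j * 'D_u ('D_(delta_mx 0 j) f) x0 by [].
  rewrite (@near_eq_derive _ _ _ _ (\sum_j (u 0 j *: 'D_(delta_mx 0 j) f))).
  - rewrite derive_sum; last first.
      by move=> j; apply: derivableZ; apply: diff_derivable; case: (f2 (delta_mx 0 j) _ Ax0).
    apply: eq_bigr => j _; rewrite deriveZ //.
    by apply: diff_derivable; case: (f2 (delta_mx 0 j) _ Ax0).
  - near=> y; rewrite fE; first by rewrite fct_sumE.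
    by near: y; exact: (open_nbhs_nbhs (conj oA Ax0)).
(* Positivity on the compact unit sphere persists for x near x0, uniformly in u; homogeneity of
   degree two extends it to all u <> 0. *)
have Qnear : \forall x \near x0, forall u, u != 0 -> 0 < Q x u.
  pose S := [set u : 'rV[R]_n | `|u| = 1].
  have cS : compact S.
    apply: bounded_closed_compact.
      exists 1; split => // y y1 u /= ->; exact: ltW.
    have -> : S = (fun u : 'rV[R]_n => `|u|) @^-1` [set (1 : R)] by [].
    apply: closed_comp => [u _|]; first exact: norm_continuous.
      exact: closed_eq.
  move/compact_near_coveringP : cS.
  move=> /(_ _ (nbhs x0) (fun x u => 0 < Q x u) _) cS.
  have : \forall x \near x0, S `<=` (fun u => 0 < Q x u).
    apply: cS => u0 Su0.
    have cQ : (fun z : 'rV[R]_n * 'rV[R]_n => Q z.2 z.1) @ (u0, x0) --> Q x0 u0.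
      rewrite /Q; apply: cvg_fsum => j; apply: cvg_fsum => i.
      apply: cvgM.
        apply: (@cvg_comp _ _ _ fst (fun u : 'rV[R]_n => u 0 _)); first exact: cvg_fst.
        exact: coord_continuous.
      apply: cvgM.
        apply: (@cvg_comp _ _ _ fst (fun u : 'rV[R]_n => u 0 _)); first exact: cvg_fst.
        exact: coord_continuous.
      apply: (@cvg_comp _ _ _ snd (H i j)); first exact: cvg_snd.
      by have [_ /(_ (delta_mx 0 i))] := f2 (delta_mx 0 j) x0 Ax0.
    have u00 : u0 != 0 by rewrite -normr_eq0 Su0 oner_eq0.
    have := cvgr_gt _ cQ 0 (Q0 _ u00).
    by move=> [] P [P1 P2] PP; exists P => // z /PP.
  apply: filterS => x Sx u u0.
  have nu : `|u| != 0 by rewrite normr_eq0.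
  have := Sx (`|u|^-1 *: u); rewrite /S /= normrZ normfV normr_id mulVf // => /(_ erefl).
  have -> : Q x (`|u|^-1 *: u) = `|u|^-2 * Q x u.
    rewrite /Q mulr_sumr; apply: eq_bigr => j _; rewrite mulr_sumr.
    apply: eq_bigr => i _; rewrite !mxE expr2 invfM; ring.
  by rewrite pmulr_rgt0 // invr_gt0 exprn_gt0 // lt0r nu normr_ge0.
have /nbhs_ballP[e /= e0 He] : \forall x \near x0, A x /\ forall u, u != 0 -> 0 < Q x u.
  by apply: filterI => //; exact: (open_nbhs_nbhs (conj oA Ax0)).
apply/nbhs_ballP; exists e => //= x xe xx0; set u := x - x0.
have u0 : u != 0 by rewrite subr_eq0.
have inb (s : R) : 0 <= s <= 1 -> ball x0 e (x0 + s *: u).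
  move=> /andP[s0 s1]; rewrite -ball_normE /= opprD addNKr normrN normrZ ger0_norm //.
  rewrite -ball_normE /= distrC -/u in xe.
  by apply: le_lt_trans xe; rewrite ler_piMl.
have xE : x0 + 1 *: u = x by rewrite scale1r /u addrC subrK.
have Ax : A x by case: (He _ xe).
pose psi (s : R) := \sum_j u 0 j * 'D_(delta_mx 0 j) f (x0 + s *: u).
have [s|s sI|c] := @MVT R psi (fun s => Q (x0 + s *: u) u) 0 1 ltr01.
- rewrite in_itv /= => /andP[s0 s1]; apply: dline.
  by case: (He _ (inb s _)) => //; rewrite !ltW.
- apply: derivable_within_continuous => s'; rewrite in_itv /= => s01.
  by apply: ex_derive; apply: dline; case: (He _ (inb s' s01)).
rewrite in_itv /= => /andP[c0 c1].
rewrite /psi xE scale0r addr0 -!fE // crit !subr0 mulr1 => ->.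
by case: (He _ (inb c _)) => [|_]; [rewrite !ltW|exact].
Unshelve. all: by end_near. Qed.

(** By the mean value theorem f x - f x0 is the derivative in direction u = x - x0 at some x0 + c u
    with 0 < c < 1. The radial direction at that point is c u, so its positive radial derivative is
    c times this one. *)
Lemma radial_gt n (A : set 'rV[R]_n) (f : 'rV[R]_n -> R) (x0 : 'rV[R]_n) :
  open A -> A x0 -> C1_on A f ->
  (\forall x \near x0, x != x0 -> 0 < 'D_(x - x0) f x) ->
  \forall x \near x0, x != x0 -> f x0 < f x.
Proof.
move=> oA Ax0 f1 rad.
have /nbhs_ballP[e /= e0 He] : \forall x \near x0, A x /\ (x != x0 -> 0 < 'D_(x - x0) f x).
  by apply: filterI => //; exact: (open_nbhs_nbhs (conj oA Ax0)).
apply/nbhs_ballP; exists e => //= x xe xx0; set u := x - x0.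
have u0 : u != 0 by rewrite subr_eq0.
have inb (s : R) : 0 <= s <= 1 -> ball x0 e (x0 + s *: u).
  move=> /andP[s0 s1]; rewrite -ball_normE /= opprD addNKr normrN normrZ ger0_norm //.
  rewrite -ball_normE /= distrC -/u in xe.
  by apply: le_lt_trans xe; rewrite ler_piMl.
have xE : x0 + 1 *: u = x by rewrite scale1r /u addrC subrK.
have dl (s : R) : 0 <= s <= 1 ->
    is_derive s 1 (fun s : R => f (x0 + s *: u)) ('D_u f (x0 + s *: u)).
  move=> s01; apply: is_derive_line; apply/derivableP/diff_derivable.
  by case: (He _ (inb s s01)) => /f1[].
have [s|s sI|c] := @MVT R (fun s : R => f (x0 + s *: u)) (fun s => 'D_u f (x0 + s *: u)) 0 1 ltr01.
- by rewrite in_itv /= => /andP[s0 s1]; apply: dl; rewrite !ltW.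
- apply: derivable_within_continuous => s'; rewrite in_itv /= => s01.
  by apply: ex_derive; apply: dl.
rewrite in_itv /= => /andP[c0 c1].
rewrite xE scale0r addr0 subr0 mulr1 -subr_gt0 => ->.
have c01 : 0 <= c <= 1 by rewrite !ltW.
have [Ac] := He _ (inb c c01).
have E : x0 + c *: u - x0 = c *: u by rewrite addrAC subrr add0r.
rewrite -subr_eq0 E scaler_eq0 (negbTE u0) orbF gt_eqF // => /(_ isT).
have [dfc _] := f1 _ Ac.
by rewrite deriveE // linearZ /= -deriveE // pmulr_rgt0.
Unshelve. all: by end_near. Qed.

End Calculus.

(** * Abstract descent for an alternating minimization *)

Section Descent.
Set Implicit Arguments.
Unset Strict Implicit.
Unset Printing Implicit Defensive.
Local Open Scope classical_set_scope.
Local Open Scope ring_scope.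
Context {R : realType} {n : nat} {W : topologicalType}.
(** Here [f r x] models KL(r || q_x) in chart coordinates, [C] the couplings, [rho] the partial
    minimum over [C], and [G] an open neighbourhood of the fixed point [x0] on which everything is
    finite and smooth. *)
Variables (x0 : 'rV[R]_n) (G : set 'rV[R]_n) (C : set W).
Variables (f : W -> 'rV[R]_n -> R) (rho : 'rV[R]_n -> R).
Hypothesis oG : open G.
Hypothesis Gx0 : G x0.
Hypothesis cC : compact C.
Hypothesis rho_le : forall x r, G x -> C r -> rho x <= f r x.
Hypothesis f_cont : forall x r, G x -> {for (r, x), continuous (fun z => f z.1 z.2)}.
Hypothesis f_drv : forall x r v, G x -> derivable (f r) x v.
Hypothesis rho_cont : forall x, G x -> {for x, continuous rho}.
Hypothesis rho_drv : forall x v, G x -> derivable rho x v.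
Hypothesis rho_gt0 : forall x, G x -> x != x0 -> 0 < rho x.
Hypothesis rho0 : rho x0 = 0.
Hypothesis rho_rad : forall x, G x -> x != x0 -> 0 < 'D_(x - x0) rho x.

(** Otherwise both [f r] and [f r - rho] have a local minimum at x, so the radial derivative of
    [rho] vanishes there, against [rho_rad]. *)
Lemma exists_descent x r : G x -> x != x0 -> C r -> f r x = rho x ->
  exists2 y, G y & f r y < f r x.
Proof.
move=> Gx xx0 Cr frx; apply: contrapT => noy.
have nG : nbhs x G by exact: (open_nbhs_nbhs (conj oG Gx)).
have D1 : 'D_(x - x0) (f r) x = 0.
  apply: derive_local_min; first exact: f_drv.
  apply: filterS nG => y Gy; rewrite leNgt; apply/negP => fy; apply: noy.
  by exists y.
have D2 : 'D_(x - x0) (f r - rho) x = 0.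
  apply: derive_local_min.
    by apply: derivableB; [exact: f_drv|exact: rho_drv].
  apply: filterS nG => y Gy; rewrite /GRing.add /= /GRing.opp /= frx subrr.
  by rewrite subr_ge0 rho_le.
have := rho_rad Gx xx0.
move: D2; rewrite deriveB; [|exact: f_drv|exact: rho_drv].
by rewrite D1 sub0r => /eqP; rewrite oppr_eq0 => /eqP ->; rewrite ltxx.
Qed.

(** Compactness of C x S: it suffices to find, around each pair (r, x), a neighbourhood and a range
    of small eta for which the property holds. *)
Lemma uniform_descent (S : set 'rV[R]_n) (eps : R) :
  compact S -> S `<=` G -> 0 < eps ->
  exists2 eta, 0 < eta & forall x r, S x -> C r -> f r x = rho x -> eps <= rho x ->
    exists2 y, G y & f r y <= f r x - eta.
Proof.
move=> cS SG eps0.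
pose P (eta : R) (z : W * 'rV[R]_n) :=
  f z.1 z.2 = rho z.2 -> eps <= rho z.2 ->
  exists2 y, G y & f z.1 y <= f z.1 z.2 - eta.
have : \forall eta \near (0 : R)^'+, (C `*` S) `<=` P eta.
  have /compact_near_coveringP := compact_setX cC cS; apply => -[r x] [/= Cr Sx].
  have Gx := SG _ Sx.
  have cf := @f_cont x r Gx.
  have crho : (fun z : W * 'rV[R]_n => rho z.2) @ (r, x) --> rho x.
    by apply: (@cvg_comp _ _ _ snd rho); [exact: cvg_snd|exact: rho_cont].
  (* If r is not optimal at x, it stays so nearby and the first premise fails. *)
  have [frx|/eqP frx] := pselect (f r x = rho x); last first.
    have : \forall z \near (r, x), f z.1 z.2 - rho z.2 != 0.
      have cfr : (fun z : W * 'rV[R]_n => f z.1 z.2 - rho z.2) @ (r, x) --> f r x - rho x.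
        exact: cvgB.
      apply: (cfr [set u | u != 0]).
      by apply: open_nbhs_nbhs; split => /=; [exact: open_neq|rewrite subr_eq0].
    move=> Q; near=> z eta => /= E _; exfalso.
    have : f z.1 z.2 - rho z.2 != 0 by near: z; exact: Q.
    by rewrite E subrr eqxx.
  (* Near [x0] the value [rho] is below eps, so the second premise fails. *)
  have [xx0|xx0] := eqVneq x x0.
    have : \forall z \near (r, x), rho z.2 < eps.
      by apply: (cvgr_lt _ crho); rewrite xx0 rho0.
    move=> Q; near=> z eta => /= _; rewrite leNgt => /negP; case.
    by near: z; exact: Q.
  (* The same competitor y serves a whole neighbourhood, where by continuity at least half of its
     gain e survives. *)
  have [y Gy fy] := exists_descent Gx xx0 Cr frx.
  have cy : (fun z : W * 'rV[R]_n => f z.1 y) @ (r, x) --> f r y.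
    have -> : (fun z : W * 'rV[R]_n => f z.1 y) =
      (fun z => f z.1 z.2) \o (fun z : W * 'rV[R]_n => (z.1, y)) by [].
    apply: (@cvg_comp _ _ _ (fun z : W * 'rV[R]_n => (z.1, y)) (fun z => f z.1 z.2));
      last exact: (@f_cont y r Gy).
    apply: (@cvg_pair _ _ _ (nbhs (r, x)) (nbhs r) (nbhs y) _ _ _ fst (fun=> y)).
      exact: cvg_fst.
    exact: cvg_cst.
  have cd : (fun z : W * 'rV[R]_n => f z.1 z.2 - f z.1 y) @ (r, x) --> f r x - f r y.
    exact: cvgB.
  set e := f r x - f r y in cd.
  have e0 : 0 < e by rewrite subr_gt0.
  have Q : \forall z \near (r, x), e / 2 < f z.1 z.2 - f z.1 y.
    by apply: (cvgr_gt _ cd); rewrite ltr_pdivrMr // mulr_natr mulr2n ltrDl.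
  near=> z eta => /= _ _; exists y => //.
  have H1 : e / 2 < f z.1 z.2 - f z.1 y by near: z; exact: Q.
  have H2 : eta < e / 2 by near: eta; apply: nbhs_right_lt; rewrite divr_gt0.
  by rewrite lerBrDr -lerBrDl ltW // (lt_trans H2).
move=> Heta.
have [eta [eta0 He]] : exists eta, 0 < eta /\ (C `*` S) `<=` P eta.
  near (0 : R)^'+ => eta; exists eta; split => //.
  by near: eta; exact: Heta.
by exists eta => // x r Sx Cr frx ex; exact: (He (r, x)).
Unshelve. all: by end_near. Qed.

Variables (left : 'rV[R]_n -> W) (step : 'rV[R]_n -> 'rV[R]_n).
Hypothesis left_in : forall x, G x -> C (left x).
Hypothesis left_rho : forall x, G x -> f (left x) x = rho x.
Hypothesis step_cont : step x @[x --> x0] --> x0.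
Hypothesis step_min : forall x y, G x -> G (step x) -> G y ->
  f (left x) (step x) <= f (left x) y.

Lemma rho_ge0 x : G x -> 0 <= rho x.
Proof. by move=> Gx; have [->|/(rho_gt0 Gx)/ltW//] := eqVneq x x0; rewrite rho0. Qed.

Lemma rho_step x : G x -> G (step x) -> rho (step x) <= rho x.
Proof.
move=> Gx Gs; apply: (le_trans (rho_le Gs (left_in Gx))).
by rewrite -(left_rho Gx); exact: step_min.
Qed.

(** V is a small ball cut by a sublevel set of [rho]: the ball alone need not be invariant, and a
    sublevel set alone need not stay near [x0]. *)
Lemma descent : exists V : set 'rV[R]_n,
  [/\ nbhs x0 V, V `<=` G, forall x, V x -> V (step x)
    & forall eps, 0 < eps -> exists H : nat, forall h x, (H <= h)%N -> V x ->
        rho (iter h step x) <= eps].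
Proof.
have /nbhs_ballP[d /= d0 dG] : nbhs x0 G by exact: (open_nbhs_nbhs (conj oG Gx0)).
pose d2 := d / 2.
have d20 : 0 < d2 by rewrite divr_gt0.
have d2d : d2 < d by rewrite ltr_pdivrMr // mulr_natr mulr2n ltrDl.
pose B2 := [set x : 'rV[R]_n | `|x - x0| <= d2].
have B2G : B2 `<=` G.
  move=> x xB; apply: dG; rewrite -ball_normE /= distrC.
  exact: le_lt_trans d2d.
have cvgN (x : 'rV[R]_n) : `|y - x0| @[y --> x] --> `|x - x0|.
  have Hx : (y - x0) @[y --> x] --> x - x0 by apply: continuousB => //; exact: cst_continuous.
  apply: (@continuous_comp _ _ _ (fun y : 'rV[R]_n => y - x0) (fun y : 'rV[R]_n => `|y|)).
    exact: Hx.
  exact: norm_continuous.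
have cB2 : compact B2.
  apply: bounded_closed_compact.
    exists (`|x0| + d2); split => [|y y1 x /= xB]; first by rewrite num_real.
    apply/ltW/(le_lt_trans _ y1); rewrite -[x](subrK x0) addrC.
    by rewrite (le_trans (ler_normD _ _)) // lerD2l.
  have -> : B2 = (fun x : 'rV[R]_n => `|x - x0|) @^-1` [set u : R | u <= d2] by [].
  by apply: closed_comp => [x _|]; [exact: cvgN|exact: closed_le].
(* Continuity of [step] at its fixed point [x0] provides d1. *)
have [d1 [d10 d12 Hd1]] : exists d1, [/\ 0 < d1, d1 <= d2
   & forall x, `|x - x0| < d1 -> B2 (step x)].
  have : \forall x \near x0, `|step x - x0| < d2.
    have : (fun x => `|step x - x0|) @ x0 --> `|x0 - x0|.
      apply: (@cvg_comp _ _ _ step (fun x : 'rV[R]_n => `|x - x0|)).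
        exact: step_cont.
      exact: cvgN.
    by rewrite subrr normr0 => /cvgr_lt; apply.
  move=> /nbhs_ballP[e /= e0 He]; exists (Num.min e d2); split.
  - by rewrite lt_min e0.
  - by rewrite ge_min lexx orbT.
  - move=> x; rewrite lt_min => /andP[xe _]; apply/ltW/He.
    by rewrite -ball_normE /= distrC.
(* [c] bounds [rho] from below on the annulus d1 <= |x - x0| <= d2, and one step from
   the inner ball does not leave the outer one. *)
have [c c0 Hc] : exists2 c, 0 < c & forall x, B2 x -> d1 <= `|x - x0| -> c <= rho x.
  have : \forall c \near (0 : R)^'+, B2 `<=` [set x | d1 <= `|x - x0| -> c <= rho x].
    move: cB2 => /compact_near_coveringP; apply => x B2x.
    have [xd|xd] := ltP `|x - x0| d1.
      have Q : \forall z \near x, `|z - x0| < d1 by exact: (cvgr_lt _ (cvgN x)).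
      near=> z c => /=; rewrite leNgt => /negP; case; near: z; exact: Q.
    have xx0 : x != x0.
      by rewrite -subr_eq0 -normr_gt0; exact: lt_le_trans xd.
    have r0 := rho_gt0 (B2G _ B2x) xx0.
    have Q : \forall z \near x, rho x / 2 < rho z.
      apply: (cvgr_gt _ (rho_cont (B2G _ B2x))).
      by rewrite ltr_pdivrMr // mulr_natr mulr2n ltrDl.
    near=> z c => /= _; apply/ltW; apply: (@lt_trans _ _ (rho x / 2)).
      by near: c; apply: nbhs_right_lt; rewrite divr_gt0.
    by near: z; exact: Q.
  move=> Hc; near (0 : R)^'+ => c; exists c => // x B2x.
  have : B2 `<=` [set x | d1 <= `|x - x0| -> c <= rho x] by near: c; exact: Hc.
  by move=> /(_ x B2x).
pose V := [set x : 'rV[R]_n | `|x - x0| < d1 /\ rho x < c].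
have VB2 : V `<=` B2 by move=> x [/= xd _]; exact: ltW (lt_le_trans xd d12).
have VG x : V x -> G x by move=> /VB2/B2G.
(* The image stays in [B2] with [rho] < c, hence cannot lie in the annulus where [rho] >= c. *)
have Vs x : V x -> V (step x).
  move=> Vx; have [xd xc] := Vx; have Bs := Hd1 _ xd.
  have sc : rho (step x) < c.
    by apply: le_lt_trans xc; apply: rho_step; [exact: VG|exact: B2G].
  by split => //; rewrite ltNge; apply/negP => /(Hc _ Bs); rewrite leNgt sc.
exists V; split => //.
  apply: filterI.
    by apply: (cvgr_lt _ (cvgN x0)); rewrite subrr normr0.
  by apply: (cvgr_lt _ (rho_cont Gx0)); rewrite rho0.
move=> eps eps0.
have [eta eta0 Heta] := uniform_descent cB2 B2G eps0.
have Viter h x : V x -> V (iter h step x).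
  by move=> Vx; elim: h => //= h; exact: Vs.
(* Each step either starts below eps, and monotonicity keeps it there, or gains at least eta from an
   initial value at most c. *)
have key h x : V x ->
    rho (iter h step x) <= eps \/ rho (iter h step x) <= c - h%:R * eta.
  move=> Vx; elim: h => [|h IH] /=.
    by right; rewrite mul0r subr0; case: Vx => _ /ltW.
  have Vh := Viter h x Vx; set y := iter h step x in IH Vh *.
  have Gy := VG _ Vh; have Gs := VG _ (Vs _ Vh).
  have [ry|ry] := ltP (rho y) eps.
    by left; apply: (le_trans (rho_step Gy Gs)); exact: ltW.
  have [z Gz fz] := Heta y (left y) (VB2 _ Vh) (left_in Gy) (left_rho Gy) ry.
  have sy : rho (step y) <= rho y - eta.
    apply: (le_trans (rho_le Gs (left_in Gy))).
    by apply: (le_trans (step_min Gy Gs Gz)); rewrite -(left_rho Gy).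
  case: IH => IH; [left|right].
    by apply: (le_trans sy); rewrite lerBlDr (le_trans IH) // lerDl ltW.
  apply: (le_trans sy); rewrite -natr1 mulrDl mul1r opprD addrA.
  by rewrite lerD2r.
(* From this h on, c - h eta < 0, which the nonnegative [rho] cannot attain. *)
exists (Num.truncn (c / eta)).+1 => h x Hh Vx.
case: (key h x Vx) => // rh.
have := rho_ge0 (VG _ (Viter h x Vx)); rewrite leNgt => /negP; case.
apply: (le_lt_trans rh); rewrite subr_lt0 -ltr_pdivrMr //.
by apply: lt_le_trans (truncnS_gt _) _; rewrite ler_nat.
Unshelve. all: by end_near. Qed.

End Descent.

(** * Gibbs' inequality and regularity of the divergence *)

Section Gibbs.
Set Implicit Arguments.
Unset Strict Implicit.
Unset Printing Implicit Defensive.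
Local Open Scope classical_set_scope.
Local Open Scope ring_scope.
Context {R : realType}.

Lemma ln_le_subr1 (x : R) : 0 < x -> ln x <= x - 1.
Proof.
move=> x0; have := @le_ln1Dx R (x - 1); rewrite [1 + _]addrC subrK; apply.
by rewrite ltrBrDr addNr.
Qed.

(** With y = sqrt x, the weak inequality gives ln x = 2 ln y <= 2 (y - 1), and y^2 - 1 exceeds this
    by (y - 1)^2 > 0. *)
Lemma ln_lt_subr1 (x : R) : 0 < x -> x != 1 -> ln x < x - 1.
Proof.
move=> x0 x1; pose y := Num.sqrt x.
have y0 : 0 < y by rewrite sqrtr_gt0.
have xy : x = y * y by rewrite -expr2 sqr_sqrtr // ltW.
have y1 : y != 1 by apply: contra_neq x1 => y1; rewrite xy y1 mulr1.
have ly := ln_le_subr1 y0.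
have : 0 < (y - 1) ^+ 2 by rewrite exprn_even_gt0 //= subr_eq0.
have -> : ln x = ln y + ln y by rewrite {1}xy lnM ?posrE.
by move: ly; rewrite expr2; clearbody y; nra.
Qed.

(** Only 0 is delicate: for 0 < y < 1 and s = sqrt y, the bound - ln s <= 1/s - 1 yields |y ln y| <=
    2 (s - s^2) <= 2 s. *)
Lemma xlnx_continuous : continuous (fun x : R => x * ln x).
Proof.
move=> x; have [x0|x0|->] := ltgtP x 0.
- rewrite /continuous_at ln0 ?ltW // mulr0.
  have : (fun=> 0 : R) @ x --> (0 : R) by exact: cvg_cst.
  apply: cvg_trans; apply: near_eq_cvg.
  near=> y; rewrite ln0 ?mulr0 //; near: y.
  by apply: filterS (lt_nbhsl x0) => y /ltW.
- by apply: cvgM; [exact: cvg_id|exact: continuous_ln].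
rewrite /continuous_at mul0r.
have c0 : 2 * Num.sqrt y @[y --> (0 : R)] --> (0 : R).
  have : 2 * Num.sqrt y @[y --> (0 : R)] --> 2 * Num.sqrt (0 : R).
    by apply: cvgM; [exact: cvg_cst|exact: sqrt_continuous].
  by rewrite sqrtr0 mulr0.
apply/cvgr0Pnorm_lt => e e0.
have Q : \forall y \near (0 : R), 2 * Num.sqrt y < e by exact: (cvgr_lt _ c0).
near=> y.
have [y0|y0] := leP y 0; first by rewrite ln0 // mulr0 normr0.
have y1 : y < 1 by near: y; exact: lt_nbhsl.
have s0 : 0 < Num.sqrt y by rewrite sqrtr_gt0.
have yE : y = Num.sqrt y * Num.sqrt y by rewrite -expr2 sqr_sqrtr // ltW.
apply: (@le_lt_trans _ _ (2 * Num.sqrt y)); last by near: y; exact: Q.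
rewrite ler0_norm; last by rewrite mulr_ge0_le0 ?ltW // ln_lt0 // y0.
have /ln_le_subr1 H : 0 < (Num.sqrt y)^-1 by rewrite invr_gt0.
rewrite lnV ?posrE // in H.
rewrite {1 2}yE lnM ?posrE //.
set s := Num.sqrt y in s0 yE H *.
have : s * s * - ln s <= s * s * (s^-1 - 1) by apply: ler_wpM2l => //; nra.
have -> : s * s * (s^-1 - 1) = s - s * s by field; rewrite gt_eqF.
nra.
Unshelve. all: by end_near. Qed.

(* The value of [KL] where q > 0.  As [ln] vanishes on nonpositive reals, x ln x is
   continuous on the whole line and no sign condition on r is needed for continuity. *)
Definition klr (X : finType) (r q : X -> R) : R :=
  \sum_x (r x * ln (r x) - r x * ln (q x)).

Lemma KLE (X : finType) (r q : X -> R) :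
  (forall x, 0 <= r x) -> (forall x, 0 < q x) -> KL r q = (klr r q)%:E.
Proof.
move=> r0 q0; rewrite /KL /klr -sumEFin; apply: eq_bigr => x _.
have [->|rx] := eqVneq (r x) 0; first by rewrite !mul0r subrr.
rewrite gt_eqF // -mulrBr ln_div ?posrE //.
by rewrite lt0r rx r0.
Qed.

(** Each term is at least r x - q x, and these differences sum to zero. *)
Lemma KL_ge0 (X : finType) (r q : X -> R) :
  (forall x, 0 <= r x) -> (forall x, 0 <= q x) -> \sum_x r x = \sum_x q x ->
  (0 <= KL r q)%E.
Proof.
move=> r0 q0 rq.
have -> : 0%E = (\sum_x (r x - q x)%:E)%E.
  by rewrite sumEFin sumrB rq subrr.
apply: lee_sum => x _; case: ifPn => [/eqP ->|rx].
  by rewrite lee_fin sub0r oppr_le0.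
case: ifPn => [_|qx]; first exact: leey.
have r1 : 0 < r x by rewrite lt0r rx r0.
have q1 : 0 < q x by rewrite lt0r qx q0.
rewrite lee_fin.
have := ln_le_subr1 (divr_gt0 q1 r1).
rewrite !ln_div ?posrE // -(ler_pM2l r1).
have -> : r x * (q x / r x - 1) = q x - r x by field.
by rewrite !mulrBr; lra.
Qed.

(** The termwise bound is an equality only where r x = q x; [leif_sum] carries the equality case to
    the sum. *)
Lemma klr_gt0 (X : finType) (r q : X -> R) :
  (forall x, 0 <= r x) -> (forall x, 0 < q x) -> \sum_x r x = \sum_x q x ->
  ~ (r =1 q) -> 0 < klr r q.
Proof.
move=> r0 q0 rq neq.
have le x : r x - q x <= r x * ln (r x) - r x * ln (q x) ?= iff (r x == q x).
  have [rx|rx] := eqVneq (r x) (q x).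
    by rewrite rx !subrr; split; rewrite ?eqxx.
  apply/leifP => /=.
  have [->|r1] := eqVneq (r x) 0; first by rewrite !mul0r subrr sub0r oppr_lt0.
  have {}r1 : 0 < r x by rewrite lt0r r1 r0.
  have q1 := q0 x.
  have n1 : q x / r x != 1.
    by apply: contra_neq rx => /divr1_eq.
  have := ln_lt_subr1 (divr_gt0 q1 r1) n1.
  rewrite !ln_div ?posrE // -(ltr_pM2l r1).
  have -> : r x * (q x / r x - 1) = q x - r x by field; rewrite gt_eqF.
  by rewrite mulrBr; lra.
have [] := leif_sum (fun x (_ : true) => le x).
rewrite sumrB rq subrr => H1 H2.
rewrite lt_neqAle H1 H2 andbT; apply/negP => /forallP H; apply: neq => x.
exact/eqP/H.
Qed.

Lemma klr_cont (X : finType) (T : topologicalType) (r q : X -> T -> R) (z : T) :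
  (forall x, {for z, continuous (r x)}) -> (forall x, {for z, continuous (q x)}) ->
  (forall x, 0 < q x z) ->
  {for z, continuous (fun z => klr (r ^~ z) (q ^~ z))}.
Proof.
move=> rc qc q0; apply: cvg_fsum => x; apply: cvgB.
  exact: (continuous_comp (rc x) (@xlnx_continuous _)).
apply: cvgM; first exact: rc.
exact: (continuous_comp (qc x) (continuous_ln (q0 x))).
Qed.

Lemma klr_derivable (X : finType) (V : normedModType R) (r : X -> R) (q : X -> V -> R)
    (z v : V) :
  (forall x, differentiable (q x) z) -> (forall x, 0 < q x z) ->
  derivable (fun z => klr r (q ^~ z)) z v.
Proof.
move=> qd q0.
have -> : (fun z => klr r (q ^~ z)) =
  \sum_(i < #|X|) (fun z => r (enum_val i) * ln (r (enum_val i)) -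
     r (enum_val i) * ln (q (enum_val i) z)).
  by apply/funext => y; rewrite fct_sumE /klr (reindex _ (onW_bij _ (@enum_val_bij X))).
apply: derivable_sum => i; apply: derivableB; first exact: derivable_cst.
apply: (@derivableZ _ _ _ (fun z => ln (q (enum_val i) z))).
apply: diff_derivable.
apply: (@differentiable_comp _ _ _ _ (q (enum_val i)) (@ln R)) => //.
by apply/derivable1_diffP; have := is_derive1_ln (q0 (enum_val i)) => ?; exact: ex_derive.
Qed.

End Gibbs.

(** * Topology of matrices and Lebesgue measure of cubes *)

Section Matrices.
Set Implicit Arguments.
Unset Strict Implicit.
Unset Printing Implicit Defensive.
Local Open Scope classical_set_scope.
Local Open Scope ring_scope.
Context {R : realType}.

Lemma mx_continuous_at (T : topologicalType) m n (f : T -> 'M[R]_(m, n)) (z : T) :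
  (forall i j, f y i j @[y --> z] --> f z i j) -> f y @[y --> z] --> f z.
Proof.
move=> fc P [e /= eP] eQ; apply: (filterS eQ) => /=.
by apply: filter_forall => i; apply: filter_forall => j; exact: (fc i j).
Qed.

(** A is the continuous image under [vec_mx] of a closed subset of a compact box of row vectors. *)
Lemma mx_compact m n (A : set 'M[R]_(m, n)) (M : R) :
  closed A -> (forall r i j, A r -> `|r i j| <= M) -> compact A.
Proof.
move=> cA bA; have cv : continuous (@vec_mx R m n).
  move=> v; apply: mx_continuous_at => i j; rewrite mxE; under eq_cvg do rewrite mxE.
  exact: coord_continuous.
have -> : A = vec_mx @` (vec_mx @^-1` A).
  apply/seteqP; split => [r Ar|_ [v Av <-]] //.
  by exists (mxvec r); rewrite /= mxvecK.
apply: continuous_compact; first exact: continuous_subspaceT.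
have Mco : compact [set v : 'rV[R]_(m * n) | forall i, v ord0 i \in `[(- M), M]].
  apply: (@rV_compact _  _ (fun=> `[(- M), M]%classic)).
  by move=> _; apply: segment_compact.
apply: subclosed_compact Mco _; first by apply: closed_comp => // v _; exact: cv.
move=> v /= Av k; case/mxvec_indexP: k => i j.
by rewrite in_itv /= -ler_norml; have := bA _ i j Av; rewrite mxE.
Qed.

Lemma row_continuous m n (k : 'I_m) : continuous (@row R m n k).
Proof.
move=> p; apply: mx_continuous_at => i j; rewrite mxE; under eq_cvg do rewrite mxE.
exact: coord_continuous.
Qed.

Lemma lebesgue_rV0 n : @lebesgue_rV R n set0 = 0%E.
Proof.
elim: n => [|n IH] /=; first by rewrite indicE in_set0.
by under eq_integral do rewrite IH; rewrite integral0.
Qed.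

(** For the sup norm a ball is a cube: its slice over x is a ball of one dimension less when x is
    within e of the first coordinate, and empty otherwise. *)
Lemma lebesgue_rV_ball n (c : 'rV[R]_n) (e : R) : 0 < e ->
  lebesgue_rV (ball c e) = (((2 * e) ^+ n)%:E)%E.
Proof.
move=> e0; elim: n c => [|n IH] c /=.
  rewrite expr0 indicE mem_set //; split => // i j; by case: j.
pose c1 := c 0 0; pose c' : 'rV[R]_n := rsubmx (c : 'rV[R]_(1 + n)).
have ballE x (v : 'rV[R]_n) : ball c e (row_mx (x%:M : 'rV[R]_1) v) <->
    ball c1 e x /\ ball c' e v.
  have El : (row_mx (x%:M : 'rV[R]_1) v : 'rV[R]_n.+1) 0 0 = x.
    rewrite (_ : 0 = lshift n (0 : 'I_1)); last exact: val_inj.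
    by apply: etrans (row_mxEl _ _ _ _) _; rewrite mxE mulr1n.
  have Er j : (row_mx (x%:M : 'rV[R]_1) v : 'rV[R]_n.+1) 0 (rshift 1 j) = v 0 j.
    exact: row_mxEr.
  split=> [[_ H]|[Hx [_ Hv]]].
    split; first by have := H 0 0; rewrite El.
    by split=> // i j; have := H i (rshift 1 j); rewrite !ord1 Er mxE.
  split => // i j; rewrite !ord1; case: (@split_ordP 1 n j) => k ->.
    by rewrite ord1 (_ : lshift n 0 = 0) ?El //; exact: val_inj.
  by rewrite Er; have := Hv 0 k; rewrite mxE.
have E x : lebesgue_rV [set v : 'rV[R]_n | ball c e (row_mx (x%:M : 'rV[R]_1) v)] =
    ((fun=> ((2 * e) ^+ n)%:E) \_ (ball c1 e)) x.
  rewrite /patch; case: ifPn => [|]; rewrite ?in_setE ?notin_setE => xc.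
    rewrite -(IH c'); congr lebesgue_rV; apply/seteqP.
    by split => v /=; rewrite ballE => // -[].
  rewrite [X in lebesgue_rV X](_ : _ = set0) ?lebesgue_rV0 //.
  by rewrite -subset0 => v /ballE[].
under eq_integral do rewrite E.
rewrite -integral_mkcond integral_cst; last exact: measurable_realfun.measurable_ball.
transitivity (((2 * e) ^+ n)%:E * (e *+ 2)%:E)%E.
  by congr (_ * _)%E; exact: (lebesgue_measure_ball c1 (ltW e0)).
by rewrite -EFinM exprSr -[e *+ 2]mulr_natl.
Qed.

End Matrices.

(** * Flattened coordinates on the parameter space *)

Section Chart.
Set Implicit Arguments.
Unset Strict Implicit.
Unset Printing Implicit Defensive.
Local Open Scope classical_set_scope.
Local Open Scope ring_scope.
Context {R : realType} {K d : nat}.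

(** The same unpacking as in [relative_lebesgue]; flat row vectors are also what the calculus and
    descent sections work with. *)
Definition coords (x : 'rV[R]_(K.-1 + K * d)) : chart_coord R K d :=
  (lsubmx x, vec_mx (rsubmx x)).

Lemma coords_is_linear : linear coords.
Proof. by move=> a x y; rewrite /coords !linearP. Qed.

HB.instance Definition _ :=
  GRing.isLinear.Build R 'rV[R]_(K.-1 + K * d) (chart_coord R K d) _ coords
    coords_is_linear.

Lemma coords_continuous : continuous coords.
Proof.
move=> x; apply: (@cvg_pair _ _ _ (nbhs x) (nbhs (lsubmx x)) (nbhs (vec_mx (rsubmx x)))
  _ _ _ lsubmx (fun x => vec_mx (rsubmx x))).
  apply: mx_continuous_at => i j; rewrite mxE; under eq_cvg do rewrite mxE.
  exact: coord_continuous.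
apply: mx_continuous_at => i j; rewrite !mxE; under eq_cvg do rewrite !mxE.
exact: coord_continuous.
Qed.

Lemma coords0 : coords 0 = 0.
Proof. by rewrite /coords !linear0. Qed.

Lemma coords_differentiable x : differentiable coords x.
Proof.
exact: (@linear_differentiable R _ (chart_coord R K d) coords x coords_continuous).
Qed.

Lemma C2_on_coords (A : set (chart_coord R K d)) (f : chart_coord R K d -> R) :
  C2_on A f -> C2_on (coords @^-1` A) (f \o coords).
Proof.
exact: (@C2_on_comp_linear R _ (chart_coord R K d) R A f coords coords_continuous).
Qed.

Lemma hessian_coords (f : chart_coord R K d -> R) x u v :
  hessian (f \o coords) x u v = hessian f (coords x) (coords u) (coords v).
Proof. exact: (@hessian_comp_linear R _ (chart_coord R K d) f coords). Qed.

(** Inverse of the chart that forgets the last weight; defined and continuous everywhere, also where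
    the weights do not sum to 1. *)
Definition uncoords (p : mix_param R K d) : 'rV[R]_(K.-1 + K * d) :=
  row_mx (\row_j p.1 0 (widen_ord (leq_pred K) j)) (mxvec p.2).

Lemma uncoords_continuous : continuous uncoords.
Proof.
move=> p; apply: mx_continuous_at => i j; rewrite ord1.
case: (split_ordP j) => k ->.
  rewrite row_mxEl mxE; under eq_cvg do rewrite row_mxEl mxE.
  apply: (@continuous_comp _ _ _ fst (fun w : 'rV[R]_K => w 0 (widen_ord (leq_pred K) k))).
    exact: cvg_fst.
  exact: coord_continuous.
case/mxvec_indexP: k => i' j'; rewrite row_mxEr mxvecE; under eq_cvg do rewrite row_mxEr mxvecE.
apply: (@continuous_comp _ _ _ snd (fun w : 'M[R]_(K, d) => w i' j')).
  exact: cvg_snd.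
exact: coord_continuous.
Qed.

Lemma iota_chartK x : uncoords (iota_chart (coords x)) = x.
Proof.
rewrite /uncoords -[RHS]hsubmxK; congr row_mx; last by rewrite /= vec_mxK.
apply/rowP => j; rewrite !mxE /=; case: insubP => [k _ kj|]; last by rewrite ltn_ord.
by rewrite !mxE; congr (x _ _); apply: val_inj; rewrite /= kj.
Qed.

Lemma uncoordsK (p : mix_param R K d) : (0 < K)%N -> \sum_k p.1 0 k = 1 ->
  iota_chart (coords (uncoords p)) = p.
Proof.
move=> K0; case: p => w b /= w1.
rewrite /iota_chart /coords /uncoords /= row_mxKl row_mxKr mxvecK; congr (_, _).
apply/rowP => k; rewrite !mxE; case: insubP => [j _ jk|].
  by rewrite !mxE; congr (w _ _); exact: val_inj.
(* Only the last index is missed by [insub]; its weight is recovered from the sum. *)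
rewrite -leqNgt => kK; case: K K0 w b w1 k kK => [//|K'] _ w _ w1 k kK.
have -> : k = ord_max by apply/val_inj/eqP; rewrite eqn_leq kK -ltnS ltn_ord.
rewrite -w1 big_ord_recr /= addrC; apply/eqP; rewrite -subr_eq0; apply/eqP.
rewrite [X in - X](eq_bigr (fun j => w 0 (widen_ord (leqnSn K') j))).
  by rewrite addrK subrr.
by move=> j _; rewrite !mxE; congr (w _ _); exact: val_inj.
Qed.

Lemma uncoords_iota_chart th : coords (uncoords (iota_chart th)) = th.
Proof.
have -> : th = coords (row_mx th.1 (mxvec th.2)).
  by case: th => w b; rewrite /coords row_mxKl row_mxKr mxvecK.
by rewrite iota_chartK.
Qed.

End Chart.

(** * Closedness and compactness of the constraint sets *)

Section Closed.
Set Implicit Arguments.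
Unset Strict Implicit.
Unset Printing Implicit Defensive.
Local Open Scope classical_set_scope.
Local Open Scope ring_scope.
Context {R : realType}.

Lemma closed_eq_cont (T : topologicalType) (f : T -> R) (c : R) :
  continuous f -> closed [set z | f z = c].
Proof.
move=> fc; have -> : [set z | f z = c] = f @^-1` [set c] by [].
by apply: closed_comp => // z _; exact: fc.
Qed.

Lemma continuous_fsum (T : topologicalType) (I : finType) (f : I -> T -> R) :
  (forall i, continuous (f i)) -> continuous (fun z => \sum_i f i z).
Proof. by move=> fc z; apply: cvg_fsum => i; exact: fc. Qed.

Lemma closed_simplex (X : finType) (T : topologicalType) (f : T -> X -> R) :
  (forall x, continuous (f ^~ x)) -> closed [set z | simplex (f z)].
Proof.
move=> fc.
have -> : [set z | simplex (f z)] =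
   (\bigcap_x ((f ^~ x) @^-1` `[0, 1])) `&` [set z | \sum_x f z x = 1].
  apply/seteqP; split => z /=.
    by move=> [H1 H2]; split => // x _; rewrite /= in_itv /= H1.
  by move=> [H1 H2]; split => // x; have := H1 x I; rewrite /= in_itv.
apply: closedI.
  apply: closed_bigI => x _; apply: closed_comp => [z _|]; first exact: fc.
  exact: itv_closed.
by apply: closed_eq_cont; exact: continuous_fsum.
Qed.

Lemma entry_continuous K L (x : 'I_K * 'I_L * 'I_2) :
  continuous (fun r : mass_array R K L => entry r x).
Proof. exact: coord_continuous. Qed.

Lemma couplings_closed K L (alpha : 'I_L -> R) psi : closed (@couplings R K L alpha psi).
Proof.
have -> : @couplings R K L alpha psi =
  [set r | simplex (entry r)] `&`
  (\bigcap_l [set r : mass_array R K L |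
      \sum_(k < K) \sum_(m < 2) entry r (k, l, m) = alpha l]) `&`
  (\bigcap_m [set r : mass_array R K L |
      \sum_(k < K) \sum_(l < L) entry r (k, l, m) = binary_law psi m]).
  apply/seteqP; split => r /=.
    by move=> [H1 H2 H3]; split; [split|] => // x _; [exact: H2|exact: H3].
  by move=> [[H1 H2] H3]; split => // x; [exact: H2|exact: H3].
apply: closedI; [apply: closedI|].
- by apply: closed_simplex => x; exact: entry_continuous.
- apply: closed_bigI => l _; apply: closed_eq_cont.
  by apply: continuous_fsum => k; apply: continuous_fsum => m; exact: entry_continuous.
- apply: closed_bigI => m _; apply: closed_eq_cont.
  by apply: continuous_fsum => k; apply: continuous_fsum => l; exact: entry_continuous.
Qed.

Lemma couplings_compact K L (alpha : 'I_L -> R) psi : compact (@couplings R K L alpha psi).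
Proof.
apply: (@mx_compact _ _ _ _ 1); first exact: couplings_closed.
move=> r i j [[H _] _ _]; case/mxvec_indexP: i => k l.
by have /andP[h0 h1] := H (k, l, j); rewrite ger0_norm.
Qed.

Lemma param_set_closed K d (B : set 'rV[R]_d) : closed B -> closed (@param_set R K d B).
Proof.
move=> cB.
have -> : @param_set R K d B = [set p : mix_param R K d | simplex (fun k => p.1 0 k)] `&`
   \bigcap_k [set p : mix_param R K d | B (row k p.2)].
  by apply/seteqP; split => p /=; move=> [H1 H2]; split => // k; [move=> _|]; exact: H2.
apply: closedI.
  apply: closed_simplex => k p.
  apply: (@continuous_comp _ _ _ fst (fun w : 'rV[R]_K => w 0 k)).
    exact: cvg_fst.
  exact: coord_continuous.
apply: closed_bigI => k _.
apply: (@closed_comp _ _ (fun p : mix_param R K d => row k p.2)) => // p _.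
apply: (@continuous_comp _ _ _ snd (@row R K d k)); first exact: cvg_snd.
exact: row_continuous.
Qed.

End Closed.

(** * Differentiability and total mass of the mixture *)

Section Mix.
Set Implicit Arguments.
Unset Strict Implicit.
Unset Printing Implicit Defensive.
Local Open Scope classical_set_scope.
Local Open Scope ring_scope.
Context {R : realType}.

Lemma mixture_differentiable K L d (e : 'I_L -> R) (t : 'I_L -> 'rV[R]_d -> R)
    (g : 'rV[R]_d -> R) (V : normedModType R) (psi : V -> mix_param R K d) (z : V) x :
  differentiable psi z ->
  (forall k l, differentiable (t l) (row k (psi z).2)) ->
  (forall k, differentiable g (row k (psi z).2)) ->
  differentiable (fun y => mixture e t g (psi y) x) z.
Proof.
case: x => [[k l] m] dpsi dt dg.
have d1 : differentiable (fun y => (psi y).1 0 k) z.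
  apply: (@differentiable_comp _ _ _ _ psi (fun p : mix_param R K d => p.1 0 k)) => //.
  apply: (@differentiable_comp _ _ _ _ fst (fun w : 'rV[R]_K => w 0 k)).
    by apply: linear_differentiable => p; exact: cvg_fst.
  exact: differentiable_coord.
have d2 : differentiable (fun y => row k (psi y).2) z.
  apply: (@differentiable_comp _ _ _ _ psi (fun p : mix_param R K d => row k p.2)) => //.
  apply: (@differentiable_comp _ _ _ _ snd (@row R K d k)).
    by apply: linear_differentiable => p; exact: cvg_snd.
  by apply: linear_differentiable; exact: row_continuous.
have dg' : differentiable (fun y => g (row k (psi y).2)) z.
  exact: (@differentiable_comp _ _ _ _ (fun y => row k (psi y).2) g).
rewrite /mixture /=.
apply: differentiableM; last first.
  rewrite /binary_law; case: (m == ord0) => //.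
  by apply: differentiableB => //; exact: differentiable_cst.
apply: differentiableM; last first.
  exact: (@differentiable_comp _ _ _ _ (fun y => row k (psi y).2) (t l)).
by apply: differentiableM => //; exact: differentiable_cst.
Qed.

Lemma big_triple K L (F : 'I_K * 'I_L * 'I_2 -> R) :
  \sum_x F x = \sum_k \sum_l (F (k, l, ord0) + F (k, l, lift ord0 ord0)).
Proof.
rewrite pair_big /= (eq_bigr (fun p => \sum_m F (p, m))); last first.
  by move=> [k l] _; rewrite big_ord_recl big_ord_recl big_ord0 addr0.
by rewrite pair_big /=; apply: eq_bigr => -[[k l] m].
Qed.

Lemma mixture_sum K L d (e : 'I_L -> R) (t : 'I_L -> 'rV[R]_d -> R)
    (g : 'rV[R]_d -> R) (p : mix_param R K d) :
  \sum_k p.1 0 k = 1 -> (forall k, \sum_l e l * t l (row k p.2) = 1) ->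
  \sum_x mixture e t g p x = 1.
Proof.
move=> w1 et; rewrite big_triple -[RHS]w1; apply: eq_bigr => k _.
rewrite -[RHS]mulr1 -(et k) mulr_sumr; apply: eq_bigr => l _.
by rewrite /mixture /binary_law /=; ring.
Qed.

End Mix.

(** * Normalization of the kernel over the observed design *)

Section Design.
Set Implicit Arguments.
Unset Strict Implicit.
Unset Printing Implicit Defensive.
Local Open Scope ring_scope.
Context {R : realType} {J T N L : nat}.
Variables (a : 'I_N -> @menu J T) (lab : 'I_L -> @menu J T * @profile J T).
Hypothesis hlab : is_ordering a lab.

Lemma eN_gt0 l : 0 < @eN R J T N a L lab l.
Proof.
have : lab l \in data a by case: hlab => _ <-; apply: imset_f.
rewrite inE => /andP[/existsP[i /eqP ai] _].
rewrite /eN divr_gt0 // ltr0n.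
  by rewrite /multiplicity; apply/card_gt0P; exists i; rewrite inE ai.
exact: leq_ltn_trans (leq0n i) (ltn_ord i).
Qed.

(** Double counting: writing each multiplicity as a sum over the i with that menu and exchanging
    sums gives the average over i of the total kernel mass on a_i, which is 1. *)
Lemma eN_tbar_sum d (B : set 'rV[R]_d) s b : (0 < N)%N ->
  (forall i, a i \in menus) -> choice_kernel B s -> B b ->
  \sum_l @eN R J T N a L lab l * tbar lab s l b = 1.
Proof.
move=> N0 ha [_ hs] Bb; have [labI labE] := hlab.
have -> : \sum_l @eN R J T N a L lab l * tbar lab s l b =
    \sum_(z in data a) (multiplicity a z.1)%:R / N%:R * s b z.1 z.2.
  rewrite -labE big_imset /=; last by move=> ? ? _ _; exact: labI.
  by apply: eq_bigl => l; rewrite inE.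
have H i : \sum_(y in a i) s b (a i) y = 1 by case: (hs b (a i) Bb (ha i)).
transitivity (\sum_(z in data a) \sum_(i | a i == z.1) N%:R^-1 * s b z.1 z.2).
  apply: eq_bigr => z _; rewrite sumr_const -mulrnAl -[_^-1 *+ _]mulr_natl.
  by congr (_%:R * _ * _); rewrite /multiplicity; apply: eq_card => i; rewrite inE.
rewrite (exchange_big_dep predT) //=.
transitivity (\sum_(i < N) (N%:R^-1 : R)); last first.
  by rewrite sumr_const card_ord -[_ *+ _]mulr_natl mulfV // pnatr_eq0 -lt0n.
apply: eq_bigr => i _; rewrite -[RHS]mulr1 -(H i) mulr_sumr.
rewrite [RHS](reindex_onto snd (fun y => (a i, y))) //=.
rewrite (eq_bigl (fun z => (a i == z.1) && (z.2 \in a i))); last first.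
  move=> [A y] /=; rewrite inE /= andbC; case: eqP => //= <-.
  by rewrite (_ : [exists j, a j == a i] = true) //; apply/existsP; exists i.
apply: eq_big => [[A y]|[A y]] /=; last by case/andP => /eqP <-.
by rewrite xpair_eqE eqxx andbT andbC.
Qed.

End Design.

(** * Transfer of the descent scheme to the algorithm *)

Theorem theorem6
  (R : realType) (J T N K d L : nat)
  (hJ : (0 < J)%N) (hT : (0 < T)%N) (hN : (0 < N)%N) (hK : (0 < K)%N)
  (hd : (0 < d)%N)
  (* design, ordering of the data, kernel, g, P^N, psi *)
  (a : 'I_N -> @menu J T) (ha : forall i, a i \in menus)
  (lab : 'I_L -> @menu J T * @profile J T) (hlab : is_ordering a lab)
  (B : set 'rV[R]_d)
  (s : 'rV[R]_d -> @menu J T -> @profile J T -> R) (hs : choice_kernel B s)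
  (g : 'rV[R]_d -> R)
  (hg_meas : measurable_fun (B : set (borel 'rV[R]_d)) g)
  (hg01 : forall b, B b -> 0 <= g b <= 1)
  (P : {ffun 'I_N -> @profile J T} -> R) (hP : np_measures a P)
  (psi : R) (hpsi : 0 <= psi <= 1) :
  let t := tbar lab s in
  let D := @param_set R K d B in
  let C := @couplings R K L (alphabar a lab P) psi in
  let q := @mixture R K L d (eN a lab) t g in
  forall
  (* oracles *)
  (left_proj : mix_param R K d -> mass_array R K L)
  (hleft : forall p, D p -> is_left_minimizer q C p (left_proj p))
  (right_proj : mass_array R K L -> mix_param R K d)
  (hright : forall r, C r -> is_right_minimizer q D r (right_proj r))
  (* random initialization *)
  (disp : measure_display) (Omega : measurableType disp)
  (Pr : probability Omega R)
  (X : {mfun Omega >-> borel (mix_param R K d)})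
  (hXD : forall om, D (X om))
  (hXpos : forall S : set (borel (mix_param R K d)), measurable S -> S `<=` D ->
     (0 < relative_lebesgue S)%E -> (0 < distribution Pr X S)%E)
  (* (1) *)
  (hB_convex : @convex_set R 'rV[R]_d B)
  (ht_pos : forall l b, B b -> 0 < t l b)
  (hg_pos : forall b, B b -> 0 < g b < 1)
  (ht_lc : forall l, log_concave B (t l))
  (hg_lc : log_concave B g)
  (* (2) *)
  (hB_compact : compact B)
  (hg_cont : {within B, continuous g})
  (ht_cont : forall l, {within B, continuous (t l)})
  (* (3) *)
  (rstar : mass_array R K L) (hrC : C rstar)
  (pstar : mix_param R K d) (hpD : D pstar)
  (hrq : entry rstar =1 q pstar)
  (hwstar : forall k, 0 < pstar.1 0 k)
  (hbstar : forall k, (B°) (row k pstar.2))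
  (* (4) *)
  (Theta0 : set (chart_coord R K d)) (hTheta0 : open Theta0)
  (U0 : set (mix_param R K d)) (hU0 : relative_nbhs D pstar U0)
  (hU0cl : closure U0 `<=` param_set (B°))
  (hiota_bij : set_bij Theta0 U0 iota_chart)
  (hiota_C1 : C1_on Theta0 (@iota_chart R K d))
  (thstar : chart_coord R K d) (hthstar : Theta0 thstar)
  (hiota_star : iota_chart thstar = pstar)
  (hunique : forall p, closure U0 p -> q p =1 q pstar -> p = pstar)
  (* (5) *)
  (B0 : set 'rV[R]_d) (hB0_open : open B0) (hB0 : B0 `<=` B°)
  (hB0_star : forall k, B0 (row k pstar.2))
  (ht_C2 : forall l, C2_on B0 (t l)) (hg_C2 : C2_on B0 g)
  (* (6) *)
  (hKL_C2 : C2_on Theta0 (fun th => fine (divergence q rstar (iota_chart th))))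
  (hKL_hess : positive_definite
     (hessian (fun th => fine (divergence q rstar (iota_chart th))) thstar))
  (* (7) *)
  (hrho_C2 : C2_at thstar (rho q C))
  (hrho_hess : positive_definite (hessian (rho q C) thstar))
  (* (8) *)
  (W0 : set (mass_array R K L)) (hW0 : relative_nbhs C rstar W0)
  (hW0_unique : forall r, W0 r ->
     forall p, is_right_minimizer q D r p -> p = right_proj r)
  (hW0_C1 : C1_on_subset W0 right_proj),
  (exists U : set (borel (mix_param R K d)),
     [/\ U `<=` D, measurable U, (0 < relative_lebesgue U)%E
       & forall p0, U p0 ->
           gap q left_proj right_proj p0 h @[h --> \oo] --> 0%E])
  /\
  (forall eps : R, 0 < eps ->
     exists H : nat, (0 < H)%N /\
       forall h, (H <= h)%N ->
         (0 < inner_prob Pr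
                [set om | certify q left_proj right_proj eps h (X om)])%E).

Proof.
move=> t D C q left_proj hleft right_proj hright disp Omega Pr X hXD hXpos.
move=> hB_convex ht_pos hg_pos ht_lc hg_lc hB_compact hg_cont ht_cont.
move=> rstar hrC pstar hpD hrq hwstar hbstar.
move=> Theta0 hTheta0 U0 hU0 hU0cl hiota_bij hiota_C1 thstar hthstar hiota_star hunique.
move=> B0 hB0_open hB0 hB0_star ht_C2 hg_C2 _ _ hrho_C2 hrho_hess.
move=> W0 hW0 hW0_unique hW0_C1.
have [A [oA Athstar rhoA]] := hrho_C2.
pose xs := uncoords pstar.
have cxs : coords xs = thstar.
  by rewrite /xs -hiota_star uncoords_iota_chart.
pose Psi (x : 'rV[R]_(K.-1 + K * d)) := iota_chart (coords x) : mix_param R K d.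
have Psixs : Psi xs = pstar by rewrite /Psi cxs hiota_star.
pose f (r : mass_array R K L) x := klr (entry r) (q (Psi x)).
pose rho' x := rho q C (coords x).
have Gtheta x : Theta0 (coords x) -> D (Psi x).
  by move=> Tx; case: hU0 => sub _ _; apply: sub; have [+ _ _] := hiota_bij; apply.
have Dsum p : D p -> \sum_x q p x = 1.
  move=> [[_ w1] Bp]; apply: mixture_sum => // k.
  by apply: (eN_tbar_sum hlab hN ha hs); exact: Bp.
have Dge0 p x : D p -> 0 <= q p x.
  move=> [[w01 _] Bp]; case: x => [[k l] m]; rewrite /q /mixture.
  have /andP[g0 g1] := hg01 _ (Bp k).
  apply: mulr_ge0; last by rewrite /binary_law; case: ifP => // _; rewrite subr_ge0.
  do 2 (apply: mulr_ge0; last by apply: ltW; first [exact: ht_pos|exact: (eN_gt0 hlab)]).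
  by case/andP: (w01 k).
have Dgt0 p x : D p -> (forall k, 0 < p.1 0 k) -> 0 < q p x.
  move=> [_ Bp] w0; case: x => [[k l] m]; rewrite /q /mixture.
  have /andP[g0 g1] := hg_pos _ (Bp k).
  apply: mulr_gt0; last by rewrite /binary_law; case: ifP => // _; rewrite subr_gt0.
  by apply: mulr_gt0 (ht_pos _ _ (Bp k)); exact: mulr_gt0 (w0 k) (eN_gt0 hlab l).
have Cge0 r x : C r -> 0 <= entry r x by move=> [[H _] _ _]; case/andP: (H x).
have Csum r : C r -> \sum_x entry r x = 1 by case=> [[]].
have Cdiv r p : C r -> D p -> (0 <= divergence q r p)%E.
  move=> Cr Dp; apply: KL_ge0 => [x|x|]; [exact: Cge0|exact: Dge0|].
  by rewrite Csum // Dsum.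
(* On [P1] all entries of q are positive and differentiable and [rho'] is C^2, so the divergence is
   the real number [f]. *)
pose P1 := [set x | [/\ A (coords x), Theta0 (coords x),
   forall k, 0 < (Psi x).1 0 k & forall k, B0 (row k (Psi x).2)]]%classic.
have P1D x : P1 x -> D (Psi x) by case=> _ /Gtheta.
have P1q x y : P1 x -> 0 < q (Psi x) y.
  by move=> Px; apply: Dgt0; [exact: P1D|case: Px].
have P1div r x : C r -> P1 x -> divergence q r (Psi x) = (f r x)%:E.
  by move=> Cr Px; apply: KLE => y; [exact: Cge0|exact: P1q].
have leftC x : P1 x -> C (left_proj (Psi x)).
  by move=> /P1D/hleft[].
have left_rho x : P1 x -> f (left_proj (Psi x)) x = rho' x.
  move=> Px; have [Cl lmin] := hleft _ (P1D _ Px).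
  rewrite /rho' /rho -/(Psi x).
  (* The infimum is attained at the oracle's answer with a finite value, which [fine] returns
     unchanged. *)
  suff -> : ereal_inf [set divergence q r (Psi x) | r in C]%classic =
    divergence q (left_proj (Psi x)) (Psi x) by rewrite P1div.
  apply/eqP; rewrite eq_le; apply/andP; split.
    by apply: ereal_inf_lbound; exists (left_proj (Psi x)).
  by apply: le_ereal_inf_tmp => _ [r Cr <-]; exact: lmin.
have rho_le x r : P1 x -> C r -> rho' x <= f r x.
  move=> Px Cr; rewrite -left_rho // -lee_fin -!P1div //; last exact: leftC.
  by case: (hleft _ (P1D _ Px)) => _; apply.
have rho_ge0 x : P1 x -> 0 <= rho' x.
  move=> Px; have := Cdiv _ _ (leftC x Px) (P1D x Px).
  by rewrite P1div ?lee_fin ?left_rho //; exact: leftC.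
have P1xs : P1 xs.
  by split; rewrite ?Psixs ?cxs.
have fstar : f rstar xs = 0.
  by rewrite /f /klr big1 // => x _; rewrite Psixs hrq subrr.
have rhos : rho' xs = 0.
  by apply/eqP; rewrite eq_le rho_ge0 // -fstar rho_le.
have Psi_diff x : Theta0 (coords x) -> differentiable Psi x.
  move=> Tx; apply: (@differentiable_comp _ _ _ _ coords (@iota_chart R K d)).
    exact: coords_differentiable.
  by case: (hiota_C1 _ Tx).
have q_diff x y : P1 x -> differentiable (fun z => q (Psi z) y) x.
  move=> [_ Tx _ Bx]; apply: mixture_differentiable => [|k l|k].
  - exact: Psi_diff.
  - by case: (ht_C2 l) => /(_ _ (Bx k))[].
  - by case: hg_C2 => /(_ _ (Bx k))[].
have f_cont x r : P1 x -> {for (r, x), continuous (fun z => f z.1 z.2)}.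
  move=> Px; apply: (@klr_cont _ _ _ (fun y z => entry z.1 y) (fun y z => q (Psi z.2) y)).
  - move=> y; apply: (@continuous_comp _ _ _ fst (fun r => entry r y)).
      exact: cvg_fst.
    exact: entry_continuous.
  - move=> y; apply: (@continuous_comp _ _ _ snd (fun x => q (Psi x) y)).
      exact: cvg_snd.
    exact/differentiable_continuous/q_diff.
  - by move=> y; exact: P1q.
have f_drv x r v : P1 x -> derivable (f r) x v.
  by move=> Px; apply: klr_derivable => y; [exact: q_diff|exact: P1q].
have nP1 : nbhs xs P1.
  have Psi_cont : Psi @ xs --> pstar.
    by rewrite -Psixs; apply/differentiable_continuous/Psi_diff; rewrite cxs.
  have n1 : nbhs xs (coords @^-1` A)%classic.
    by apply: coords_continuous; rewrite cxs; exact: open_nbhs_nbhs.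
  have n2 : nbhs xs (coords @^-1` Theta0)%classic.
    by apply: coords_continuous; rewrite cxs; exact: open_nbhs_nbhs.
  have n3 : \forall x \near xs, forall k, 0 < (Psi x).1 0 k.
    apply: (@filter_forall _ _ (fun k x => 0 < (Psi x).1 0 k) (nbhs xs) _) => k.
    have : (fun x => (Psi x).1 0 k) @ xs --> pstar.1 0 k.
      apply: (@cvg_comp _ _ _ Psi (fun p : mix_param R K d => p.1 0 k)).
        exact: Psi_cont.
      apply: (@continuous_comp _ _ _ fst (fun w : 'rV[R]_K => w 0 k)).
        exact: cvg_fst.
      exact: coord_continuous.
    by move=> /cvgr_gt; apply.
  have n4 : \forall x \near xs, forall k, B0 (row k (Psi x).2).
    apply: (@filter_forall _ _ (fun k x => B0 (row k (Psi x).2)) (nbhs xs) _) => k.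
    have : (fun x => row k (Psi x).2) @ xs --> row k pstar.2.
      apply: (@cvg_comp _ _ _ Psi (fun p : mix_param R K d => row k p.2)).
        exact: Psi_cont.
      apply: (@continuous_comp _ _ _ snd (@row R K d k)).
        exact: cvg_snd.
      exact: row_continuous.
    by apply; exact: open_nbhs_nbhs.
  apply: (filterS _ (filterI (filterI n1 n2) (filterI n3 n4))) => x [[? ?] [? ?]].
  by split.
have rhoA' : C2_on (coords @^-1` A)%classic rho'.
  exact: (C2_on_coords rhoA).
have oA' : open (coords @^-1` A)%classic.
  by apply: open_comp => // x _; exact: coords_continuous.
have A'xs : (coords @^-1` A)%classic xs by rewrite /= cxs.
(* [rho'] vanishes at [xs] and is nonnegative nearby. *)
have crit v : 'D_v rho' xs = 0.
  apply: derive_local_min.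
    by apply: diff_derivable; case: rhoA' => /(_ _ A'xs)[].
  by apply: filterS nP1 => x Px; rewrite rhos rho_ge0.
have hess : positive_definite (hessian rho' xs).
  move=> u u0.
  have cu0 : coords u != 0.
    by apply: contra_neq u0 => cu; rewrite -[u]iota_chartK cu -coords0 iota_chartK.
  have -> : hessian rho' xs u u = hessian (rho q C) (coords xs) (coords u) (coords u).
    exact: hessian_coords.
  by rewrite cxs; exact: hrho_hess.
have rad := derive_radial_gt0 oA' A'xs rhoA' hess crit.
have pos : \forall x \near xs, x != xs -> rho' xs < rho' x.
  exact: (radial_gt oA' A'xs (proj1 rhoA') rad).
(* The radial conditions hold only near [xs], while descent takes place on an open set: hence the
   interior of [P2]. *)
pose P2 := [set x | [/\ P1 x, x != xs -> 0 < 'D_(x - xs) rho' x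
  & x != xs -> rho' xs < rho' x]]%classic.
pose G := (P2°)%classic.
have oG : open G by exact: open_interior.
have Gxs : G xs.
  suff : nbhs xs P2 by [].
  by apply: (filterS _ (filterI nP1 (filterI rad pos))) => x [? [? ?]]; split.
have GP x : G x -> P2 x by exact: interior_subset.
have GP1 x : G x -> P1 x by move=> /GP[].
pose left x := left_proj (Psi x).
pose step x := uncoords (right_proj (left x)).
have PsiStep x : P1 x -> Psi (step x) = right_proj (left x).
  by move=> Px; apply: uncoordsK => //; case: (hright _ (leftC _ Px)) => -[[]].
have step_min x y : G x -> G (step x) -> G y -> f (left x) (step x) <= f (left x) y.
  move=> /GP1 Gx /GP1 Gs /GP1 Gy; have Cl := leftC _ Gx.
  have [_ /(_ _ (P1D _ Gy))] := hright _ Cl.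
  by rewrite -/(left x) -PsiStep // !P1div.
have cC : compact C by exact: couplings_compact.
(* By Gibbs' inequality KL(r || q_{p*}) > 0 = KL(r* || q_{p*}) for r <> r*, so off any
   neighbourhood of r* no r in the compact set C minimizes KL(. || q_p) for p near p*. *)
have left_cont : left @ xs --> rstar.
  move=> O nO.
  have : \forall x \near xs, (C `<=` [set r | O r \/ f rstar x < f r x])%classic.
    move: cC => /compact_near_coveringP.
    move=> /(_ _ (nbhs xs) (fun x r => O r \/ f rstar x < f r x) _); apply => r Cr.
    have [->|rr] := eqVneq r rstar.
      by near=> r' x => /=; left; near: r'.
    have fr : 0 < f r xs.
      apply: klr_gt0 => [y|y||]; [exact: Cge0|exact: P1q| |].
        by rewrite Csum // Dsum //; exact: P1D.
      move=> E; move/eqP: rr; apply; apply/matrixP => i j.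
      case/mxvec_indexP: i => k l.
      by have := E (k, l, j); rewrite Psixs -hrq.
    have Q : \forall z \near (r, xs), 0 < f z.1 z.2 - f rstar z.2.
      have c1 := @f_cont xs r P1xs.
      pose Z := (mass_array R K L * 'rV[R]_(K.-1 + K * d))%type.
      have c2 : (fun z : Z => f rstar z.2) @ (r, xs) --> f rstar xs.
        have c3 := @f_cont xs rstar P1xs.
        apply: (@cvg_comp _ _ _ (fun z : Z => (rstar, z.2)) (fun z => f z.1 z.2)).
          apply: (@cvg_pair _ _ _ (nbhs (r, xs)) (nbhs rstar) (nbhs xs)
            _ _ _ (fun=> rstar) snd); [exact: cvg_cst|exact: cvg_snd].
        exact: c3.
      have c4 : (fun z : Z => f z.1 z.2 - f rstar z.2) @ (r, xs) -->
          f r xs - f rstar xs.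
        exact: cvgB.
      by apply: (cvgr_gt _ c4); rewrite fstar subr0.
    by case: Q => S nS SQ; exists S => // z /SQ; rewrite subr_gt0; right.
  move=> H; apply: (filterS _ (filterI H nP1)) => x [/= Hx Px].
  case: (Hx (left x) (leftC _ Px)) => // /lt_geF.
  by rewrite left_rho // rho_le.
(* The divergence is zero at [pstar] and nonnegative on [D], and the minimizer at [rstar] is
   unique. *)
have right_star : right_proj rstar = pstar.
  apply/esym; apply: hW0_unique; first by case: hW0.
  split=> // p' Dp'.
  by rewrite -Psixs P1div // fstar; exact: Cdiv.
have step_cont : step @ xs --> xs.
  (* The local C^1 extension F replaces [right_proj]. Since [W0] is a neighbourhood relative to [C]
     only, they are compared at [left x], which lies in [C]. *)
  have [Ob [F [oO Ors F1 FE]]] : exists (Ob : set (mass_array R K L)) F,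
     [/\ open Ob, Ob rstar, C1_on Ob F & forall y, Ob y -> W0 y -> F y = right_proj y].
    by apply: hW0_C1; case: hW0.
  have W0rs : W0 rstar by case: hW0.
  have Fcont : (uncoords \o F \o left) @ xs --> xs.
    rewrite [X in _ --> X](_ : xs = uncoords (F rstar)); last by rewrite FE // right_star.
    apply: (@cvg_comp _ _ _ left (uncoords \o F)); first exact: left_cont.
    apply: (@continuous_comp _ _ _ F uncoords).
      by apply: differentiable_continuous; case: (F1 _ Ors).
    exact: uncoords_continuous.
  apply: cvg_trans Fcont; apply: near_eq_cvg; first exact: nbhs_filter.
  have nO : nbhs rstar Ob by exact: open_nbhs_nbhs.
  have nW : nbhs rstar [set r | C r -> W0 r]%classic by case: hW0.
  have nl : nbhs xs (left @^-1` (Ob `&` [set r | C r -> W0 r]))%classic.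
    by apply: left_cont; exact: filterI.
  apply: (filterS _ (filterI nP1 nl)) => x [Px [Ol Wl]] /=; rewrite /step FE //.
  exact/Wl/leftC.
have [V [nV VG Vstep Vunif]] : exists V : set 'rV[R]_(K.-1 + K * d),
  [/\ nbhs xs V, (V `<=` G)%classic, forall x, V x -> V (step x)
    & forall eps, 0 < eps -> exists H : nat, forall h x, (H <= h)%N -> V x ->
        rho' (iter h step x) <= eps].
  apply: (@descent R _ _ xs G C f rho' oG Gxs cC _ _ _ _ _ _ rhos _ left step) => //.
  - by move=> x r /GP1; exact: rho_le.
  - by move=> x r /GP1; exact: f_cont.
  - by move=> x r v /GP1; exact: f_drv.
  - move=> x /GP1[Ax _ _ _]; apply: differentiable_continuous.
    by case: rhoA' => /(_ _ Ax)[].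
  - move=> x v /GP1[Ax _ _ _]; apply: diff_derivable.
    by case: rhoA' => /(_ _ Ax)[].
  - by move=> x /GP[_ _]; rewrite rhos.
  - by move=> x /GP[].
  - by move=> x /GP1; exact: leftC.
  - by move=> x /GP1; exact: left_rho.
have VP1 x : V x -> P1 x by move=> /VG/GP1.
have Viter h x : V x -> V (iter h step x).
  by move=> Vx; elim: h => //= h; exact: Vstep.
(* The chart conjugates the algorithm to [step], so the gap at time h is [rho'] at the h-th
   iterate. *)
have iterE h x : V x -> iterate left_proj right_proj (Psi x) h = Psi (iter h step x).
  move=> Vx; elim: h => //= h IH; rewrite PsiStep; last exact/VP1/Viter.
  by rewrite /iterate /= -/(iterate left_proj right_proj (Psi x) h) IH.
have gapE h x : V x ->
    gap q left_proj right_proj (Psi x) h = (rho' (iter h step x))%:E.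
  move=> Vx; have Ph := VP1 _ (Viter h x Vx).
  by rewrite /gap iterE // (P1div _ _ (leftC _ Ph) Ph) (left_rho _ Ph).
have /nbhs_ballP[e /= e0 eV] := nV.
(* A box in the chart inside [V]: its relative Lebesgue measure is explicit. *)
pose U := (D `&` uncoords @^-1` ball xs e)%classic.
have UV p : U p -> V (uncoords p) /\ Psi (uncoords p) = p.
  move=> [[[_ w1] _] Up]; split; first exact: eV.
  exact: uncoordsK.
have UD : (U `<=` D)%classic by move=> p [].
(* [D] is closed since the compact [B] is, and the other factor is open. *)
have mU : measurable (U : set (borel (mix_param R K d))).
  apply: measurableI.
    rewrite -[D]setCK; apply: measurableC; apply: sub_sigma_algebra.
    apply: closed_openC; apply: param_set_closed.
    by apply: compact_closed => //; exact: norm_hausdorff.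
  apply: sub_sigma_algebra; apply: open_comp; last exact: ball_open.
  by move=> p _; exact: uncoords_continuous.
have lU : (0 < relative_lebesgue (U : set (mix_param R K d)))%E.
  rewrite /relative_lebesgue (_ : [set x | _]%classic = ball xs e).
    by rewrite lebesgue_rV_ball // lte_fin exprn_gt0 // mulr_gt0.
  apply/seteqP; split => x /=; rewrite -/(coords x).
    by move=> [_ /=]; rewrite iota_chartK.
  move=> xe; split; first by apply/P1D/VP1/eV.
  by rewrite /= iota_chartK.
split.
  exists U; split => // p0 /UV[Vp Ep].
  rewrite -Ep; have -> : gap q left_proj right_proj (Psi (uncoords p0)) =
      EFin \o (fun h => rho' (iter h step (uncoords p0))).
    by apply/funext => h; rewrite gapE.
  apply: cvg_EFin; first by near=> h.
  apply/cvgr0Pnorm_le => eps eps0.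
  have [H HH] := Vunif eps eps0.
  near=> h; rewrite /= ger0_norm; last exact/rho_ge0/VP1/Viter.
  by apply: HH => //; near: h; exact: nbhs_infty_ge.
move=> eps eps0; have [H HH] := Vunif eps eps0.
exists H.+1; split => // h Hh.
(* The event that the initialization falls in [U] is measurable, has positive probability and is
   contained in the certification event. *)
apply: (lt_le_trans (hXpos U mU UD lU)).
apply: ereal_sup_ubound; exists (X @^-1` U)%classic => //; split => /=.
  exact: measurable_funPTI.
move=> om /= /UV[Vp Ep]; rewrite /certify; apply/existsP.
(* [certify] tests the gap at the successor of its index, so the last index reaches the full number
   of iterations. *)
case: h Hh => // h Hh; exists ord_max => /=.
by rewrite -Ep gapE // lee_fin; apply: HH => //; exact: ltnW.
Unshelve. all: by end_near. Qed.
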